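(* A path $\rho$ in $\mathcal S$ (of an ABC process) is just iff $\rho=\widehat\pi$ for some path $\pi$ in $\mathcal U$ that satisfies the LTL formula $\mathbf{F}\mathbf{G}\,\mathit{en}(\nu)\Rightarrow\mathbf{G}\mathbf{F}\,\nu$ for every abstract transition $\nu$ whose label $\ell(\nu)\in Act$ is a non-blocking action (i.e. $\ell(\nu)\in\mathcal B!\cup\{\tau\}$).
   Context: ABC: sets $\mathcal A$ (agent identifiers), $\mathcal B$ (broadcast names), $\mathcal C$ (handshake names); $H=\mathcal C\cup\{\bar c\mid c\in\mathcal C\}$, $\bar{\bar c}=c$, $\bar Z=\{\bar c\mid c\in Z\}$; $Act=\mathcal B!\cup\mathcal B?\cup H\cup\{\tau\}$ with $\mathcal B!=\{b!\}$, $\mathcal B?=\{b?\}$. Non-blocking actions are $\tau$ and the broadcasts $b!$. A relabelling $f$ maps $\mathcal B\to\mathcal B$, $\mathcal C\to\mathcal C$, extended by $f(\bar c)=\overline{f(c)}$, $f(b\sharp)=f(b)\sharp$, $f(\tau)=\tau$. Expressions: $0$, $\alpha.E$, $E+F$, $E|F$, $E\backslash c$ ($c\in H$), $E[f]$, $A\in\mathcal A$ with guarded defining equations $A\stackrel{def}{=}P$. Transitions are given by the rules (with $\eta\in H\cup\{\tau\}$): (Act) $\alpha.E\xrightarrow{\alpha}E$; (Sum-l/r) a transition of $E$ (resp. $F$) is a transition of $E+F$; (Par-l/r) $E\xrightarrow{\eta}E'$ gives $E|F\xrightarrow{\eta}E'|F$, and symmetrically; (Comm) $E\xrightarrow{c}E'$,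 $F\xrightarrow{\bar c}F'$ give $E|F\xrightarrow{\tau}E'|F'$; (Bro-l) $E\xrightarrow{b\sharp_1}E'$ ($\sharp_1\in\{!,?\}$) and $F$ has no $b?$-transition give $E|F\xrightarrow{b\sharp_1}E'|F$; (Bro-r) symmetric; (Bro-c) $E\xrightarrow{b\sharp_1}E'$, $F\xrightarrow{b\sharp_2}F'$ give $E|F\xrightarrow{b(\sharp_1\circ\sharp_2)}E'|F'$ with $!\circ?=?\circ!=!$, $?\circ?=?$, $!\circ!$ undefined; (Rel) $E\xrightarrow{\ell}E'$ gives $E[f]\xrightarrow{f(\ell)}E'[f]$; (Res) $E\xrightarrow{\ell}E'$, $\ell\notin\{c,\bar c\}$ give $E\backslash c\xrightarrow{\ell}E'\backslash c$; (Rec) $P\xrightarrow{\ell}E'$, $A\stackrel{def}{=}P$ give $A\xrightarrow{\ell}E'$. $\mathcal S$: states are the expressions and the transitions $t=(P,\alpha,Q)$; edges $P\to t\to Q$. Paths (in $\mathcal S$ and $\mathcal U$) are finite or infinite sequences of states linked by edges; only paths that are infinite or end in an expression are considered. Decomposition: each transition $P|Q\xrightarrow{\ell}R$ derives via the rules from either a transition $P\xrightarrow{}P'$ and the state $Q$ ($R=P'|Q$), or transitions $P\to P'$ and $Q\to Q'$ ($R=P'|Q'$), or the state $P$ and a transition $Q\to Q'$ ($R=P|Q'$); a decomposition of a path $\pi$ of $P|Q$ into paths $\pi_1$ of $P$ and $\pi_2$ of $Q$ (notation $\pi\in\pi_1|\pi_2$) chooses such a decomposition for each transition and concatenates the left components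 into $\pi_1$ and right components into $\pi_2$ ($\pi$ may be infinite with one of $\pi_1,\pi_2$ finite). Each transition $P[f]\xrightarrow{\ell}R$ (resp. of $P\backslash c$) stems from a transition $P\to P'$ with $R=P'[f]$ (resp. $P'\backslash c$), giving decompositions of paths of $P[f]$, $P\backslash c$ into paths of $P$. $Y$-justness ($Y\subseteq H$) is the largest family of predicates on paths in $\mathcal S$ such that: a finite $Y$-just path ends in an expression all of whose outgoing transitions are labelled in $Y\cup\mathcal B?$; a $Y$-just path of $P|Q$ can be decomposed into an $X$-just path of $P$ and a $Z$-just path of $Q$ with $X\cup Z\subseteq Y$ and $X\cap\bar Z=\emptyset$; a $Y$-just path of $P\backslash c$ decomposes into a $(Y\cup\{c,\bar c\})$-just path of $P$; a $Y$-just path of $P[f]$ decomposes into an $f^{-1}(Y)$-just path of $P$; every suffix of a $Y$-just path is $Y$-just. A path is just if it is $Y$-just for some $Y\subseteq H$. Derivations: each derivation of a transition from the rules is named: $(\alpha\to P)$ for (Act) on $\alpha.P$; $\chi|\zeta$ for (Comm) or (Bro-c) from derivations $\chi,\zeta$ of the premises; $\chi|Q$ for (Par-l) or (Bro-l) from $\chi$ with $Q$ the right component; $P|\zeta$ for (Par-r)/(Bro-r); $\chi{+}Q$, $P{+}\chi$, $\chi[f]$, $\chi\backslash c$, $A{:}\chi$ for (Sum-l), (Sum-r), (Rel), (Res), (Rec). For a derivation $\chi$ of $P\xrightarrow{\alpha}Q$: $src(\chi)=P$, $target(\chi)=Q$, $\ell(\chi)=\alpha$. $\mathcal U$: states are expressions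 and derivations; edges $src(\chi)\to\chi\to target(\chi)$. $\widehat P=P$, $\widehat\chi=(src(\chi),\ell(\chi),target(\chi))$, extended elementwise to paths. Concurrency $\smile^\bullet$ is the smallest relation on derivations such that (whenever the composed derivations exist): $\chi|Q\smile^\bullet P|\zeta$ and $P|\zeta\smile^\bullet\chi|Q$ if $src(\chi)=P$, $src(\zeta)=Q$; $\chi|\varsigma\smile^\bullet P|\zeta$ and $\varsigma|\chi\smile^\bullet\zeta|P$ if $src(\chi)=P$, $src(\varsigma)=src(\zeta)$, $\ell(\varsigma)\in\mathcal B?$; $\chi\smile^\bullet\zeta$ implies $\chi{+}P\smile^\bullet\zeta{+}P$, $P{+}\chi\smile^\bullet P{+}\zeta$, $\chi|P\smile^\bullet\zeta|P$, $P|\chi\smile^\bullet P|\zeta$; $\chi\smile^\bullet\zeta$ implies $\chi|P\smile^\bullet\zeta|\xi$, $\chi|\xi\smile^\bullet\zeta|P$, $P|\chi\smile^\bullet\xi|\zeta$, $\xi|\chi\smile^\bullet P|\zeta$ if $P=src(\xi)$; $\chi\smile^\bullet\zeta$ implies $\chi|\varsigma\smile^\bullet\zeta|\xi$ and $\varsigma|\chi\smile^\bullet\xi|\zeta$ if $src(\varsigma)=src(\xi)$ and $\ell(\varsigma)\in\mathcal B?$; $\chi\smile^\bullet\zeta$ and $\varsigma\smile^\bullet\xi$ imply $\chi|\varsigma\smile^\bullet\zeta|\xi$; $\chi\smile^\bullet\zeta$ implies $\chi\backslash c\smile^\bullet\zeta\backslash c$, $\chi[f]\smile^\bullet\zeta[f]$,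 $A{:}\chi\smile^\bullet A{:}\zeta$. $\equiv$ is the smallest equivalence on derivations $\chi$ with $\ell(\chi)\notin\mathcal B?$ such that (whenever derivations exist): $\chi|P\equiv\chi|Q$, $P|\chi\equiv Q|\chi$; $\chi|\varsigma\equiv\chi|P$ and $\varsigma|\chi\equiv P|\chi$ if $\ell(\chi)\in\mathcal B!$; $\chi{+}P\equiv\chi\equiv P{+}\chi$, $A{:}\chi\equiv\chi$; $\chi\equiv\zeta$ implies $\chi\backslash c\equiv\zeta\backslash c$, $\chi[f]\equiv\zeta[f]$, $\chi|P\equiv\zeta|P$, $P|\chi\equiv P|\zeta$; $\chi\equiv\zeta$ and $\varsigma\equiv\xi$ imply $\chi|\varsigma\equiv\zeta|\xi$. Abstract transitions are the $\equiv$-classes; elements are representatives; $\ell([\chi]_\equiv)=\ell(\chi)$. Atomic propositions on states $u$ of $\mathcal U$: $u\models\nu$ iff $u$ is a derivation $\zeta$ with $[\zeta]_\equiv=\nu$; $P\models\mathit{en}(\nu)$ for an expression $P$ iff $P=src(\chi)$ for some representative $\chi$ of $\nu$; $\zeta\models\mathit{en}(\nu)$ for a derivation $\zeta$ iff $\chi\smile^\bullet\zeta$ for some representative $\chi$ of $\nu$. LTL on paths of $\mathcal U$: $\pi\models\mathbf{FG}\phi$ iff some suffix has $\phi$ in all its states (for finite $\pi$: $\phi$ holds in its last state); $\pi\models\mathbf{GF}\phi$ iff $\phi$ holds in infinitely many states (for finite $\pi$: in its last state). *)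

(* Defs.v *)
From Stdlib Require Import Classical.

Set Implicit Arguments.
Unset Strict Implicit.

(** * Actions and expressions of ABC *)

Section Syntax.

Variables A B C : Type.

Inductive hs : Type :=
| Name (c : C)
| CoName (c : C).

Definition bar (h : hs) : hs :=
  match h with Name c => CoName c | CoName c => Name c end.

Inductive sharp : Type := Snd | Rcv.

(* [Bro b Snd] is b!, [Bro b Rcv] is b?. *)
Inductive act : Type :=
| Bro (b : B) (s : sharp)
| Hs (h : hs)
| Tau.

Definition sharp_comp (s1 s2 : sharp) : option sharp :=
  match s1, s2 with
  | Snd, Rcv | Rcv, Snd => Some Snd
  | Rcv, Rcv => Some Rcv
  | Snd, Snd => None
  end.

Definition is_hs_or_tau (a : act) : Prop :=
  match a with Bro _ _ => False | Hs _ | Tau => True end.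

Definition is_send (a : act) : Prop := exists b, a = Bro b Snd.
Definition is_receive (a : act) : Prop := exists b, a = Bro b Rcv.
Definition non_blocking (a : act) : Prop := is_send a \/ a = Tau.

Record relabelling : Type := Relabelling { relB : B -> B; relC : C -> C }.

Definition rel_hs (f : relabelling) (h : hs) : hs :=
  match h with Name c => Name (relC f c) | CoName c => CoName (relC f c) end.

Definition rel_act (f : relabelling) (a : act) : act :=
  match a with
  | Bro b s => Bro (relB f b) s
  | Hs h => Hs (rel_hs f h)
  | Tau => Tau
  end.

Inductive expr : Type :=
| Nil
| Pre (a : act) (E : expr)
| Sum (E F : expr)
| Par (E F : expr)
| Res (E : expr) (c : hs)
| Rel (E : expr) (f : relabelling)
| Agent (X : A).

(* Every agent identifier occurs within the scope of a prefix. *)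
Fixpoint guarded (E : expr) : Prop :=
  match E with
  | Nil | Pre _ _ => True
  | Sum E F | Par E F => guarded E /\ guarded F
  | Res E _ | Rel E _ => guarded E
  | Agent _ => False
  end.

(** * Names of derivations *)

Inductive deriv : Type :=
| DAct (a : act) (P : expr)
| DPar (x y : deriv)
| DParL (x : deriv) (Q : expr)
| DParR (P : expr) (y : deriv)
| DSumL (x : deriv) (Q : expr)
| DSumR (P : expr) (x : deriv)
| DRel (x : deriv) (f : relabelling)
| DRes (x : deriv) (c : hs)
| DRec (X : A) (x : deriv).

Fixpoint src (x : deriv) : expr :=
  match x with
  | DAct a P => Pre a P
  | DPar x y => Par (src x) (src y)
  | DParL x Q => Par (src x) Q
  | DParR P y => Par P (src y)
  | DSumL x Q => Sum (src x) Q
  | DSumR P x => Sum P (src x)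
  | DRel x f => Rel (src x) f
  | DRes x c => Res (src x) c
  | DRec X _ => Agent X
  end.

Fixpoint target (x : deriv) : expr :=
  match x with
  | DAct _ P => P
  | DPar x y => Par (target x) (target y)
  | DParL x Q => Par (target x) Q
  | DParR P y => Par P (target y)
  | DSumL x _ | DSumR _ x | DRec _ x => target x
  | DRel x f => Rel (target x) f
  | DRes x c => Res (target x) c
  end.

(* On a [DPar] that is not a derivation the value is irrelevant. *)
Fixpoint label (x : deriv) : act :=
  match x with
  | DAct a _ => a
  | DPar x y =>
      match label x, label y with
      | Bro b s1, Bro _ s2 =>
          match sharp_comp s1 s2 with Some s => Bro b s | None => Tau end
      | _, _ => Tau
      end
  | DParL x _ | DParR _ x | DSumL x _ | DSumR _ x | DRes x _ | DRec _ x => label x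
  | DRel x f => rel_act f (label x)
  end.

(** * Structural operational semantics *)

(* [defn X] is the right-hand side of the defining equation of [X]. *)
Variable defn : A -> expr.

(* [derives_wrt rcv x P a Q]: [x] names a derivation of P --a--> Q, where the
   negative premise "F has no b?-transition" is read as [~ rcv F b]. *)
Inductive derives_wrt (rcv : expr -> B -> Prop) : deriv -> expr -> act -> expr -> Prop :=
| R_Act a E :
    derives_wrt rcv (DAct a E) (Pre a E) a E
| R_SumL x E F a E' :
    derives_wrt rcv x E a E' ->
    derives_wrt rcv (DSumL x F) (Sum E F) a E'
| R_SumR x E F a F' :
    derives_wrt rcv x F a F' ->
    derives_wrt rcv (DSumR E x) (Sum E F) a F'
| R_ParL x E F a E' :
    derives_wrt rcv x E a E' -> is_hs_or_tau a ->
    derives_wrt rcv (DParL x F) (Par E F) a (Par E' F)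
| R_ParR x E F a F' :
    derives_wrt rcv x F a F' -> is_hs_or_tau a ->
    derives_wrt rcv (DParR E x) (Par E F) a (Par E F')
| R_Comm x y E F c E' F' :
    derives_wrt rcv x E (Hs c) E' -> derives_wrt rcv y F (Hs (bar c)) F' ->
    derives_wrt rcv (DPar x y) (Par E F) Tau (Par E' F')
| R_BroL x E F b s E' :
    derives_wrt rcv x E (Bro b s) E' -> ~ rcv F b ->
    derives_wrt rcv (DParL x F) (Par E F) (Bro b s) (Par E' F)
| R_BroR x E F b s F' :
    derives_wrt rcv x F (Bro b s) F' -> ~ rcv E b ->
    derives_wrt rcv (DParR E x) (Par E F) (Bro b s) (Par E F')
| R_BroC x y E F b s1 s2 s E' F' :
    derives_wrt rcv x E (Bro b s1) E' -> derives_wrt rcv y F (Bro b s2) F' ->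
    sharp_comp s1 s2 = Some s ->
    derives_wrt rcv (DPar x y) (Par E F) (Bro b s) (Par E' F')
| R_Rel x E f a E' :
    derives_wrt rcv x E a E' ->
    derives_wrt rcv (DRel x f) (Rel E f) (rel_act f a) (Rel E' f)
| R_Res x E c a E' :
    derives_wrt rcv x E a E' -> a <> Hs c -> a <> Hs (bar c) ->
    derives_wrt rcv (DRes x c) (Res E c) a (Res E' c)
| R_Rec x X a E' :
    derives_wrt rcv x (defn X) a E' ->
    derives_wrt rcv (DRec X x) (Agent X) a E'.

(* The negative premises make the rules self-referential: the intended [rcv] is
   one for which [rcv F b] holds exactly when [F] has a b?-transition. *)
Definition coherent (rcv : expr -> B -> Prop) : Prop :=
  forall F b, rcv F b <-> exists x F', derives_wrt rcv x F (Bro b Rcv) F'.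

(* The b?-transitions of E|F exist as soon as E or F has one, so [rcv] can be
   given by a positive definition. For guarded defining equations it is
   coherent, and is the only coherent choice: [can_receive_coherent] and
   [coherent_unique] below. *)
Inductive can_receive : expr -> B -> Prop :=
| cr_Pre b E : can_receive (Pre (Bro b Rcv) E) b
| cr_SumL E F b : can_receive E b -> can_receive (Sum E F) b
| cr_SumR E F b : can_receive F b -> can_receive (Sum E F) b
| cr_ParL E F b : can_receive E b -> can_receive (Par E F) b
| cr_ParR E F b : can_receive F b -> can_receive (Par E F) b
| cr_Rel E f b : can_receive E b -> can_receive (Rel E f) (relB f b)
| cr_Res E c b : can_receive E b -> can_receive (Res E c) b
| cr_Rec X b : can_receive (defn X) b -> can_receive (Agent X) b.

Definition derives : deriv -> expr -> act -> expr -> Prop := derives_wrt can_receive.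

Definition is_derivation (x : deriv) : Prop := exists P a Q, derives x P a Q.

Definition transition (P : expr) (a : act) (Q : expr) : Prop :=
  exists x, derives x P a Q.

Lemma derives_src_label_target x P a Q :
  derives x P a Q -> src x = P /\ label x = a /\ target x = Q.
Proof.
unfold derives; intros H; induction H; simpl;
  repeat match goal with H : _ /\ _ |- _ => destruct H end;
  repeat match goal with
    | H : label _ = _ |- _ => rewrite H
    | H : src _ = _ |- _ => rewrite H
    | H : target _ = _ |- _ => rewrite H
  end; auto.
now rewrite H1.
Qed.

Lemma derives_wrt_can_receive rcv x F a F' :
  derives_wrt rcv x F a F' -> forall b, a = Bro b Rcv -> can_receive F b.
Proof.
intros H; induction H; intros b0 e; subst; try discriminate; simpl in *;
  try contradiction; try (constructor; now auto).
- injection e as -> ->; destruct s1, s2; try discriminate; apply cr_ParL; auto.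
- destruct a; try discriminate; injection e as <- ->; apply cr_Rel; auto.
Qed.

Lemma can_receive_derives_wrt rcv :
  (forall F b, rcv F b -> can_receive F b) ->
  forall E,
  guarded E \/ (forall X b, can_receive (defn X) b ->
                  exists x F', derives_wrt rcv x (defn X) (Bro b Rcv) F') ->
  forall b, can_receive E b -> exists x F', derives_wrt rcv x E (Bro b Rcv) F'.
Proof.
intros Hr E.
induction E as [|a E IH|E IHE F IHF|E IHE F IHF|E IH c|E IH f|X]; simpl;
  intros g b H.
- inversion H.
- inversion H; subst; eauto using derives_wrt.
- inversion H as [|? ? ? K|? ? ? K| | | | |]; subst.
  + destruct (IHE ltac:(tauto) _ K) as (x & F' & D); eauto using derives_wrt.
  + destruct (IHF ltac:(tauto) _ K) as (x & F' & D); eauto using derives_wrt.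
- inversion H as [| | |? ? ? K|? ? ? K| | |]; subst.
  + destruct (IHE ltac:(tauto) _ K) as (x & E' & D).
    destruct (classic (rcv F b)) as [N|N].
    * destruct (IHF ltac:(tauto) _ (Hr _ _ N)) as (y & F' & D').
      exists (DPar x y), (Par E' F'); eapply R_BroC; eauto.
    * exists (DParL x F), (Par E' F); now apply R_BroL.
  + destruct (IHF ltac:(tauto) _ K) as (y & F' & D).
    destruct (classic (rcv E b)) as [N|N].
    * destruct (IHE ltac:(tauto) _ (Hr _ _ N)) as (x & E' & D').
      exists (DPar x y), (Par E' F'); eapply R_BroC; eauto.
    * exists (DParR E y), (Par E F'); now apply R_BroR.
- inversion H as [| | | | | |? ? ? K|]; subst.
  destruct (IH g _ K) as (x & E' & D).
  exists (DRes x c), (Res E' c); apply R_Res; auto; discriminate.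
- inversion H as [| | | | |? ? b' K| |]; subst.
  destruct (IH g _ K) as (x & E' & D).
  exists (DRel x f), (Rel E' f); exact (R_Rel f D).
- destruct g as [[]|g].
  inversion H as [| | | | | | |? ? K]; subst.
  destruct (g _ _ K) as (x & F' & D).
  exists (DRec X x), F'; now apply R_Rec.
Qed.

Lemma can_receive_coherent :
  (forall X, guarded (defn X)) -> coherent can_receive.
Proof.
intros Hg F b; split.
- apply can_receive_derives_wrt; auto.
  right; intros X b'; apply can_receive_derives_wrt; auto.
- intros (x & F' & D); exact (derives_wrt_can_receive D eq_refl).
Qed.

Lemma coherent_unique rcv :
  (forall X, guarded (defn X)) -> coherent rcv ->
  forall F b, rcv F b <-> can_receive F b.
Proof.
intros Hg Hc.
assert (Hr : forall F b, rcv F b -> can_receive F b).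
{ intros F b H; apply Hc in H; destruct H as (x & F' & D).
  exact (derives_wrt_can_receive D eq_refl). }
intros F b; split; auto.
intros H; apply Hc; revert H; apply can_receive_derives_wrt; auto.
right; intros X b'; apply can_receive_derives_wrt; auto.
Qed.

(** * Concurrency and equivalence of derivations *)

(* "Whenever the composed derivations exist" is rendered by requiring both
   sides of each conclusion to be derivations. *)
Inductive conc : deriv -> deriv -> Prop :=
| conc_lr x y P Q :
    src x = P -> src y = Q ->
    is_derivation (DParL x Q) -> is_derivation (DParR P y) ->
    conc (DParL x Q) (DParR P y)
| conc_rl x y P Q :
    src x = P -> src y = Q ->
    is_derivation (DParR P y) -> is_derivation (DParL x Q) ->
    conc (DParR P y) (DParL x Q)
| conc_recv_r x s y P :
    src x = P -> src s = src y -> is_receive (label s) ->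
    is_derivation (DPar x s) -> is_derivation (DParR P y) ->
    conc (DPar x s) (DParR P y)
| conc_recv_l x s y P :
    src x = P -> src s = src y -> is_receive (label s) ->
    is_derivation (DPar s x) -> is_derivation (DParL y P) ->
    conc (DPar s x) (DParL y P)
| conc_SumL x y P :
    conc x y -> is_derivation (DSumL x P) -> is_derivation (DSumL y P) ->
    conc (DSumL x P) (DSumL y P)
| conc_SumR x y P :
    conc x y -> is_derivation (DSumR P x) -> is_derivation (DSumR P y) ->
    conc (DSumR P x) (DSumR P y)
| conc_ParL x y P :
    conc x y -> is_derivation (DParL x P) -> is_derivation (DParL y P) ->
    conc (DParL x P) (DParL y P)
| conc_ParR x y P :
    conc x y -> is_derivation (DParR P x) -> is_derivation (DParR P y) ->
    conc (DParR P x) (DParR P y)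
| conc_ParL_Par x y z P :
    conc x y -> P = src z ->
    is_derivation (DParL x P) -> is_derivation (DPar y z) ->
    conc (DParL x P) (DPar y z)
| conc_Par_ParL x y z P :
    conc x y -> P = src z ->
    is_derivation (DPar x z) -> is_derivation (DParL y P) ->
    conc (DPar x z) (DParL y P)
| conc_ParR_Par x y z P :
    conc x y -> P = src z ->
    is_derivation (DParR P x) -> is_derivation (DPar z y) ->
    conc (DParR P x) (DPar z y)
| conc_Par_ParR x y z P :
    conc x y -> P = src z ->
    is_derivation (DPar z x) -> is_derivation (DParR P y) ->
    conc (DPar z x) (DParR P y)
| conc_Par_recv_r x y s z :
    conc x y -> src s = src z -> is_receive (label s) ->
    is_derivation (DPar x s) -> is_derivation (DPar y z) ->
    conc (DPar x s) (DPar y z)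
| conc_Par_recv_l x y s z :
    conc x y -> src s = src z -> is_receive (label s) ->
    is_derivation (DPar s x) -> is_derivation (DPar z y) ->
    conc (DPar s x) (DPar z y)
| conc_Par x y s z :
    conc x y -> conc s z ->
    is_derivation (DPar x s) -> is_derivation (DPar y z) ->
    conc (DPar x s) (DPar y z)
| conc_Res x y c :
    conc x y -> is_derivation (DRes x c) -> is_derivation (DRes y c) ->
    conc (DRes x c) (DRes y c)
| conc_Rel x y f :
    conc x y -> is_derivation (DRel x f) -> is_derivation (DRel y f) ->
    conc (DRel x f) (DRel y f)
| conc_Rec x y X :
    conc x y -> is_derivation (DRec X x) -> is_derivation (DRec X y) ->
    conc (DRec X x) (DRec X y).

Definition eqd_dom (x : deriv) : Prop := is_derivation x /\ ~ is_receive (label x).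

Inductive eqd : deriv -> deriv -> Prop :=
| eqd_refl x : eqd_dom x -> eqd x x
| eqd_sym x y : eqd x y -> eqd y x
| eqd_trans x y z : eqd x y -> eqd y z -> eqd x z
| eqd_ParL_ctx x P Q :
    eqd_dom (DParL x P) -> eqd_dom (DParL x Q) -> eqd (DParL x P) (DParL x Q)
| eqd_ParR_ctx x P Q :
    eqd_dom (DParR P x) -> eqd_dom (DParR Q x) -> eqd (DParR P x) (DParR Q x)
| eqd_sendL x s P :
    is_send (label x) ->
    eqd_dom (DPar x s) -> eqd_dom (DParL x P) -> eqd (DPar x s) (DParL x P)
| eqd_sendR x s P :
    is_send (label x) ->
    eqd_dom (DPar s x) -> eqd_dom (DParR P x) -> eqd (DPar s x) (DParR P x)
| eqd_SumL x P : eqd_dom (DSumL x P) -> eqd_dom x -> eqd (DSumL x P) x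
| eqd_SumR x P : eqd_dom (DSumR P x) -> eqd_dom x -> eqd x (DSumR P x)
| eqd_Rec x X : eqd_dom (DRec X x) -> eqd_dom x -> eqd (DRec X x) x
| eqd_Res x y c :
    eqd x y -> eqd_dom (DRes x c) -> eqd_dom (DRes y c) -> eqd (DRes x c) (DRes y c)
| eqd_Rel x y f :
    eqd x y -> eqd_dom (DRel x f) -> eqd_dom (DRel y f) -> eqd (DRel x f) (DRel y f)
| eqd_ParL x y P :
    eqd x y -> eqd_dom (DParL x P) -> eqd_dom (DParL y P) -> eqd (DParL x P) (DParL y P)
| eqd_ParR x y P :
    eqd x y -> eqd_dom (DParR P x) -> eqd_dom (DParR P y) -> eqd (DParR P x) (DParR P y)
| eqd_Par x y s z :
    eqd x y -> eqd s z -> eqd_dom (DPar x s) -> eqd_dom (DPar y z) ->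
    eqd (DPar x s) (DPar y z).

(* Abstract transitions are the equivalence classes, as sets of derivations;
   [nu x] says that [x] is a representative of [nu], i.e. [x] has class [nu]. *)
Definition abstract_transition (nu : deriv -> Prop) : Prop :=
  exists x, eqd_dom x /\ forall y, nu y <-> eqd x y.

Definition abs_label (nu : deriv -> Prop) (a : act) : Prop :=
  exists x, nu x /\ label x = a.

(** * Paths *)

Section Paths.

Variable S : Type.

(* A finite sequence of length n is [Some] below n and [None] from n on. *)
Definition sequence : Type := nat -> option S.

Definition suffix (n : nat) (p : sequence) : sequence := fun m => p (n + m).

Definition occurs (p : sequence) (n : nat) : Prop := p n <> None.

(* A path may start in any state, but if finite it ends in one satisfying
   [final]. *)
Definition is_path (edge : S -> S -> Prop) (final : S -> Prop) (p : sequence) : Prop :=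
  occurs p 0 /\
  (forall n, occurs p (1 + n) -> occurs p n) /\
  (forall n s t, p n = Some s -> p (1 + n) = Some t -> edge s t) /\
  (forall n s, p n = Some s -> p (1 + n) = None -> final s).

(* Linear-time temporal logic, with formulas as predicates on paths. On a
   finite path both FG phi and GF phi say that phi holds in the last state. *)
Definition ltl_atom (phi : S -> Prop) (p : sequence) : Prop :=
  exists s, p 0 = Some s /\ phi s.
Definition ltl_F (phi : sequence -> Prop) (p : sequence) : Prop :=
  exists n, occurs p n /\ phi (suffix n p).
Definition ltl_G (phi : sequence -> Prop) (p : sequence) : Prop :=
  forall n, occurs p n -> phi (suffix n p).
Definition ltl_imp (phi psi : sequence -> Prop) (p : sequence) : Prop :=
  phi p -> psi p.

End Paths.

(* The Kripke structure S. *)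
Inductive sstate : Type :=
| SExpr (P : expr)
| STrans (P : expr) (a : act) (Q : expr).

Inductive sedge : sstate -> sstate -> Prop :=
| sedge_out P a Q : transition P a Q -> sedge (SExpr P) (STrans P a Q)
| sedge_in P a Q : transition P a Q -> sedge (STrans P a Q) (SExpr Q).

Definition sfinal (s : sstate) : Prop := exists P, s = SExpr P.

Definition is_spath : sequence sstate -> Prop := is_path sedge sfinal.

(* The Kripke structure U. *)
Inductive ustate : Type :=
| UExpr (P : expr)
| UDeriv (x : deriv).

Inductive uedge : ustate -> ustate -> Prop :=
| uedge_out x : is_derivation x -> uedge (UExpr (src x)) (UDeriv x)
| uedge_in x : is_derivation x -> uedge (UDeriv x) (UExpr (target x)).

Definition ufinal (u : ustate) : Prop := exists P, u = UExpr P.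

Definition is_upath : sequence ustate -> Prop := is_path uedge ufinal.

Definition hat_deriv (x : deriv) : sstate := STrans (src x) (label x) (target x).

Definition hat (u : ustate) : sstate :=
  match u with UExpr P => SExpr P | UDeriv x => hat_deriv x end.

Definition hat_path (p : sequence ustate) : sequence sstate :=
  fun n => option_map hat (p n).

Definition holds_abs (nu : deriv -> Prop) (u : ustate) : Prop :=
  match u with UExpr _ => False | UDeriv z => nu z end.

Definition enabled (nu : deriv -> Prop) (u : ustate) : Prop :=
  match u with
  | UExpr P => exists x, nu x /\ P = src x
  | UDeriv z => exists x, nu x /\ conc x z
  end.

(** * Decomposition of paths *)

(* A transition of P|Q together with a way to derive it from a transition
   and/or a state of P and of Q. *)
Inductive dec_par_state : sstate -> sstate -> sstate -> Prop :=
| dps_expr P Q :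
    dec_par_state (SExpr (Par P Q)) (SExpr P) (SExpr Q)
| dps_left x Q : is_derivation (DParL x Q) ->
    dec_par_state (hat_deriv (DParL x Q)) (hat_deriv x) (SExpr Q)
| dps_both x y : is_derivation (DPar x y) ->
    dec_par_state (hat_deriv (DPar x y)) (hat_deriv x) (hat_deriv y)
| dps_right P y : is_derivation (DParR P y) ->
    dec_par_state (hat_deriv (DParR P y)) (SExpr P) (hat_deriv y).

(* [l] sends each position of a path to a position of its component, standing
   still while the component does not move, and reaching all of it. *)
Definition tracks (p p1 : sequence sstate) (l : nat -> nat) : Prop :=
  l 0 = 0 /\
  (forall n, l (1 + n) = l n \/ l (1 + n) = 1 + l n) /\
  (forall m, occurs p1 m -> exists n, occurs p n /\ l n = m).

(* The components are paths, so transitions and expressions alternate in them;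
   hence [l] advances twice over each transition in which the left component
   takes part and not at all over the others, and likewise for [r]. *)
Definition decomp_par (p p1 p2 : sequence sstate) : Prop :=
  is_spath p1 /\ is_spath p2 /\
  exists l r : nat -> nat,
    tracks p p1 l /\ tracks p p2 r /\
    forall n s, p n = Some s ->
      exists s1 s2, p1 (l n) = Some s1 /\ p2 (r n) = Some s2 /\ dec_par_state s s1 s2.

Inductive dec_res_state (c : hs) : sstate -> sstate -> Prop :=
| drs_expr P : dec_res_state c (SExpr (Res P c)) (SExpr P)
| drs_trans x : is_derivation (DRes x c) ->
    dec_res_state c (hat_deriv (DRes x c)) (hat_deriv x).

Inductive dec_rel_state (f : relabelling) : sstate -> sstate -> Prop :=
| dls_expr P : dec_rel_state f (SExpr (Rel P f)) (SExpr P)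
| dls_trans x : is_derivation (DRel x f) ->
    dec_rel_state f (hat_deriv (DRel x f)) (hat_deriv x).

Definition decomp_unary (dec : sstate -> sstate -> Prop) (p p1 : sequence sstate) : Prop :=
  is_spath p1 /\
  forall n, match p n, p1 n with
            | Some s, Some s1 => dec s s1
            | None, None => True
            | _, _ => False
            end.

(** * Justness *)

Definition hset : Type := hs -> Prop.

Definition in_Y_or_receive (Y : hset) (a : act) : Prop :=
  (exists h, a = Hs h /\ Y h) \/ is_receive a.

(* "A path of P" is a path whose first state is the expression P. *)
Record just_family (J : hset -> sequence sstate -> Prop) : Prop := JustFamily {
  jf_path : forall Y p, J Y p -> is_spath p;
  jf_finite : forall Y p, J Y p ->
    forall n P, p n = Some (SExpr P) -> p (1 + n) = None ->
    forall a Q, transition P a Q -> in_Y_or_receive Y a;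
  jf_par : forall Y p, J Y p ->
    forall P Q, p 0 = Some (SExpr (Par P Q)) ->
    exists (p1 p2 : sequence sstate) (X Z : hset),
      decomp_par p p1 p2 /\ J X p1 /\ J Z p2 /\
      (forall h, X h \/ Z h -> Y h) /\
      (forall h, ~ (X h /\ Z (bar h)));
  jf_res : forall Y p, J Y p ->
    forall P c, p 0 = Some (SExpr (Res P c)) ->
    exists p1, decomp_unary (dec_res_state c) p p1 /\
      J (fun h => Y h \/ h = c \/ h = bar c) p1;
  jf_rel : forall Y p, J Y p ->
    forall P f, p 0 = Some (SExpr (Rel P f)) ->
    exists p1, decomp_unary (dec_rel_state f) p p1 /\
      J (fun h => Y (rel_hs f h)) p1;
  jf_suffix : forall Y p, J Y p ->
    forall n, occurs p n -> J Y (suffix n p)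
}.

Definition Y_just (Y : hset) (p : sequence sstate) : Prop :=
  exists J, just_family J /\ J Y p.

Definition just (p : sequence sstate) : Prop := exists Y, Y_just Y p.

Lemma Y_just_largest :
  just_family Y_just /\
  forall J, just_family J -> forall Y p, J Y p -> Y_just Y p.
Proof.
split; [split|]; intros.
- destruct H as (J & HJ & H); exact (jf_path HJ H).
- destruct H as (J & HJ & H); exact (jf_finite HJ H H0 H1 H2).
- destruct H as (J & HJ & H).
  destruct (jf_par HJ H H0) as (p1 & p2 & X & Z & D & J1 & J2 & K).
  exists p1, p2, X, Z; split; [exact D|split; [|split; [|exact K]]]; now exists J.
- destruct H as (J & HJ & H).
  destruct (jf_res HJ H H0) as (p1 & D & K).
  exists p1; split; [exact D|]; now exists J.
- destruct H as (J & HJ & H).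
  destruct (jf_rel HJ H H0) as (p1 & D & K).
  exists p1; split; [exact D|]; now exists J.
- destruct H as (J & HJ & H); exists J; split; [exact HJ|].
  exact (jf_suffix HJ H H0).
- now exists J.
Qed.

End Syntax.

Arguments Tau {B C}.
Arguments Nil {A B C}.

(* Main.v *)
From Stdlib Require Import Classical ClassicalEpsilon FunctionalExtensionality Lia.
Require Import Defs.

Set Implicit Arguments.
Unset Strict Implicit.

(** Every abstract transition has a canonical representative, obtained by
    deleting sums, recursion unfoldings, idle components and broadcast receivers,
    and two derivations are equivalent iff their canonical representatives
    coincide. A derivation is never concurrent with an equivalent one, so
    FG en(nu) excludes GF nu, and the temporal formula just says that nu is not
    persistently enabled. Call a path of U Y-fair if all its persistently enabled
    abstract transitions are labelled in Y. A path is Y-just iff it is the image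
    of a Y-fair path of U.

    A transition enabled in a state of P|Q is one enabled in the left component,
    one enabled in the right component, or a handshake between two such. Hence
    fairness decomposes along P|Q as justness does, with the handshakes that stay
    enabled in the two components as X and Z: one in X whose complement is in Z
    would give a persistently enabled tau. So the images of Y-fair paths form a
    justness family.

    Conversely, fix a decomposition for each Y-just path. Following these down to
    prefixes, sums and agent identifiers selects a derivation for each transition.
    The resulting path of U is Y-fair by induction on the canonical representative:
    once an enabled transition has survived one step, the path is in the scope of
    a parallel composition, restriction or relabelling, and the transition can be
    pushed into the components. *)

(** * Sequences *)

Lemma occurs_iff (S : Type) (p : sequence S) (n : nat) :
  occurs p n <-> exists s, p n = Some s.
Proof.
unfold occurs; destruct (p n) as [s|]; split; try congruence; eauto.
intros [s H]; discriminate.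
Qed.

Definition map_seq (S T : Type) (c : S -> T) (p : sequence S) : sequence T :=
  fun n => option_map c (p n).

Lemma map_seq_Some (S T : Type) (c : S -> T) (p : sequence S) (n : nat) (t : T) :
  map_seq c p n = Some t <-> exists s, p n = Some s /\ t = c s.
Proof.
unfold map_seq; destruct (p n) as [s|]; simpl; split.
- intros [= <-]; eauto.
- intros (s' & [= <-] & ->); reflexivity.
- discriminate.
- intros (s & H & _); discriminate.
Qed.

Lemma map_seq_None (S T : Type) (c : S -> T) (p : sequence S) (n : nat) :
  map_seq c p n = None <-> p n = None.
Proof. unfold map_seq; destruct (p n); simpl; split; congruence. Qed.

Lemma occurs_map_seq (S T : Type) (c : S -> T) (p : sequence S) (n : nat) :
  occurs (map_seq c p) n <-> occurs p n.
Proof. unfold occurs; now rewrite map_seq_None. Qed.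

Lemma path_occurs_le (S : Type) (edge : S -> S -> Prop) (final : S -> Prop)
    (p : sequence S) (n m : nat) :
  is_path edge final p -> n <= m -> occurs p m -> occurs p n.
Proof. intros (_ & closed & _) L; induction L; auto. Qed.

Lemma path_suffix (S : Type) (edge : S -> S -> Prop) (final : S -> Prop)
    (p : sequence S) (k : nat) :
  is_path edge final p -> occurs p k -> is_path edge final (suffix k p).
Proof.
unfold is_path, occurs, suffix; intros (_ & closed & edges & ends) Hk; repeat split; [|intros n..].
- now rewrite <- plus_n_O.
- rewrite <- !plus_n_Sm; apply closed.
- rewrite <- !plus_n_Sm; apply edges.
- rewrite <- !plus_n_Sm; apply ends.
Qed.

Lemma path_invariant (S : Type) (edge : S -> S -> Prop) (final I : S -> Prop)
    (p : sequence S) (s0 : S) :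
  is_path edge final p -> p 0 = Some s0 -> I s0 ->
  (forall s t, edge s t -> I s -> I t) ->
  forall n s, p n = Some s -> I s.
Proof.
intros (_ & closed & edges & _) H0 I0 step n; induction n as [|n IH]; intros t Ht.
- congruence.
- destruct (proj1 (occurs_iff p n)) as [s Hs].
  { apply closed, occurs_iff; eauto. }
  eauto.
Qed.

Lemma map_seq_path (S T : Type) (edge : S -> S -> Prop) (final : S -> Prop)
    (edge' : T -> T -> Prop) (final' : T -> Prop) (c : S -> T) (p : sequence S) :
  (forall s t, edge s t -> edge' (c s) (c t)) ->
  (forall s, final s -> final' (c s)) ->
  is_path edge final p -> is_path edge' final' (map_seq c p).
Proof.
intros Hedge Hfinal (nonempty & closed & edges & ends); repeat split.
- now apply occurs_map_seq.
- intros n; rewrite !occurs_map_seq; apply closed.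
- intros n s' t'; rewrite !map_seq_Some; intros (s & Hs & ->) (t & Ht & ->); eauto.
- intros n s'; rewrite map_seq_Some, map_seq_None; intros (s & Hs & ->) Hn; eauto.
Qed.

Lemma map_seq_path_inv (S T : Type) (edge : S -> S -> Prop) (final : S -> Prop)
    (edge' : T -> T -> Prop) (final' : T -> Prop) (c : S -> T) (p : sequence S) :
  (forall n s t, p n = Some s -> p (1 + n) = Some t -> edge' (c s) (c t) -> edge s t) ->
  (forall s, final' (c s) -> final s) ->
  is_path edge' final' (map_seq c p) -> is_path edge final p.
Proof.
intros Hedge Hfinal (nonempty & closed & edges & ends); repeat split.
- now apply occurs_map_seq in nonempty.
- intros n; rewrite <- !(occurs_map_seq c); apply closed.
- intros n s t Hs Ht; apply (Hedge n); auto; apply (edges n); apply map_seq_Some; eauto.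
- intros n s Hs Hn; apply Hfinal, (ends n); [apply map_seq_Some; eauto|].
  now apply map_seq_None.
Qed.

(** * Eventually always *)

Definition eventually_always (S : Type) (phi : S -> Prop) (p : sequence S) : Prop :=
  exists N, occurs p N /\ forall n s, N <= n -> p n = Some s -> phi s.

Lemma suffix_add (S : Type) (p : sequence S) (k n m : nat) :
  k + n = m -> suffix k p n = p m.
Proof. now intros <-. Qed.

Lemma ltl_FG_atom (S : Type) (phi : S -> Prop) (p : sequence S) :
  ltl_F (ltl_G (ltl_atom phi)) p <-> eventually_always phi p.
Proof.
split; intros (N & HN & H); exists N; split; auto.
- intros n s L Hs; destruct (H (n - N)) as (s' & Hs' & phi_s').
  + unfold occurs; rewrite (suffix_add p (m := n)) by lia; congruence.
  + unfold suffix in Hs'; replace (N + (n - N + 0)) with n in Hs' by lia; congruence.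
- intros n Hn; apply occurs_iff in Hn; destruct Hn as [s Hs]; exists s; split.
  + unfold suffix in *; now rewrite <- plus_n_O.
  + apply (H (N + n)); [lia|exact Hs].
Qed.

Lemma ltl_GF_atom (S : Type) (phi : S -> Prop) (p : sequence S) :
  ltl_G (ltl_F (ltl_atom phi)) p <->
  forall N, occurs p N -> exists n s, N <= n /\ p n = Some s /\ phi s.
Proof.
split; intros H N HN; destruct (H N HN) as (n & K).
- destruct K as (_ & s & Hs & phi_s); exists (N + n), s; split; [lia|].
  unfold suffix in Hs; now rewrite <- plus_n_O in Hs.
- destruct K as (s & L & Hs & phi_s); exists (n - N).
  assert (E : suffix N p (n - N) = Some s) by (rewrite (suffix_add p (m := n)); auto; lia).
  split; [apply occurs_iff; eauto|exists s].
  split; auto; unfold suffix in *; now rewrite <- plus_n_O.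
Qed.

Lemma eventually_always_sub (S : Type) (phi psi : S -> Prop) (p : sequence S) :
  (forall n s, p n = Some s -> phi s -> psi s) ->
  eventually_always phi p -> eventually_always psi p.
Proof. intros sub (N & HN & H); exists N; split; eauto. Qed.

Lemma eventually_always_and (S : Type) (phi psi : S -> Prop) (p : sequence S) :
  eventually_always phi p -> eventually_always psi p ->
  eventually_always (fun s => phi s /\ psi s) p.
Proof.
intros (N & HN & H) (M & HM & K); exists (max N M); split.
- destruct (PeanoNat.Nat.max_spec N M) as [[_ ->]|[_ ->]]; auto.
- intros n s L Hs; split; [apply (H n)|apply (K n)]; auto; lia.
Qed.

Lemma eventually_always_somewhere (S : Type) (phi : S -> Prop) (p : sequence S) :
  eventually_always phi p -> exists n s, p n = Some s /\ phi s.
Proof.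
intros (N & HN & H); apply occurs_iff in HN; destruct HN as [s Hs]; eauto.
Qed.

Lemma eventually_always_suffix (S : Type) (phi : S -> Prop) (p : sequence S) (k : nat) :
  occurs p k -> eventually_always phi (suffix k p) <-> eventually_always phi p.
Proof.
intros Hk; split; intros (N & HN & H).
- exists (k + N); split; auto; intros n s L Hs; apply (H (n - k)); [lia|].
  rewrite (suffix_add p (m := n)); auto; lia.
- exists (N - k); split.
  + unfold occurs; rewrite (suffix_add p (m := max N k)) by lia.
    destruct (PeanoNat.Nat.max_spec N k) as [[_ ->]|[_ ->]]; auto.
  + intros n s L; apply H; lia.
Qed.

Lemma eventually_always_last (S : Type) (edge : S -> S -> Prop) (final phi : S -> Prop)
    (p : sequence S) (n : nat) (s : S) :
  is_path edge final p -> p n = Some s -> p (1 + n) = None ->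
  eventually_always phi p <-> phi s.
Proof.
intros Hp Hs Hn; assert (last : forall m, occurs p m -> m <= n).
{ intros m Hm; apply NNPP; intros L.
  apply (path_occurs_le (n := 1 + n) Hp) in Hm; [contradiction|lia]. }
split.
- intros (N & HN & H); apply (H n); auto.
- intros phi_s; exists n; split; [apply occurs_iff; eauto|].
  intros m t L Ht; replace m with n in Ht; [congruence|].
  apply PeanoNat.Nat.le_antisymm; auto; apply last, occurs_iff; eauto.
Qed.

Lemma eventually_always_map (S T : Type) (c : S -> T) (phi : T -> Prop) (p : sequence S) :
  eventually_always phi (map_seq c p) <-> eventually_always (fun s => phi (c s)) p.
Proof.
split; intros (N & HN & H); apply occurs_map_seq in HN || apply (occurs_map_seq c) in HN;
  exists N; split; auto; intros n s L Hs.
- apply (H n); auto; apply map_seq_Some; eauto.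
- apply map_seq_Some in Hs; destruct Hs as (s' & Hs & ->); eauto.
Qed.

(** * Removing stutter *)

Definition slow (l : nat -> nat) : Prop :=
  forall n, l (1 + n) = l n \/ l (1 + n) = 1 + l n.

Lemma slow_mono (l : nat -> nat) : slow l -> forall n m, n <= m -> l n <= l m.
Proof.
intros Hl n m L; induction L as [|m L IH]; auto.
destruct (Hl m) as [E|E]; simpl in E; lia.
Qed.

Lemma slow_le (l : nat -> nat) : l 0 = 0 -> slow l -> forall n, l n <= n.
Proof.
intros start Hl n; induction n as [|n IH]; [lia|].
destruct (Hl n) as [E|E]; simpl in E; lia.
Qed.

(* Generalizes [tracks] to sequences over different state spaces. *)
Definition follows (S T : Type) (p : sequence S) (q : sequence T) (l : nat -> nat) : Prop :=
  l 0 = 0 /\ slow l /\ forall m, occurs q m -> exists n, occurs p n /\ l n = m.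

Definition stutter_image (S T : Type) (c : S -> T) (p : sequence S) (q : sequence T) : Prop :=
  exists l, follows p q l /\ forall n s, p n = Some s -> q (l n) = Some (c s).

Lemma eventually_always_stutter_image (S T : Type) (c : S -> T) (phi : T -> Prop)
    (p : sequence S) (q : sequence T) :
  stutter_image c p q ->
  eventually_always phi q <-> eventually_always (fun s => phi (c s)) p.
Proof.
intros (l & (_ & Hl & onto) & image); split.
- intros (M & HM & H); destruct (onto M HM) as (N & HN & <-).
  exists N; split; auto; intros n s L Hs; apply (H (l n)); auto.
  now apply slow_mono.
- intros (N & HN & H); apply occurs_iff in HN; destruct HN as [sN HsN].
  exists (l N); split; [apply occurs_iff; eauto|]; intros m t L Ht.
  destruct (onto m) as (n & Hn & <-); [apply occurs_iff; eauto|].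
  apply occurs_iff in Hn; destruct Hn as [s Hs].
  destruct (PeanoNat.Nat.le_ge_cases N n) as [Ln|Ln].
  + assert (t = c s) as -> by (rewrite (image _ _ Hs) in Ht; congruence); eauto.
  + assert (l n = l N) as E by (apply PeanoNat.Nat.le_antisymm; auto; now apply slow_mono).
    assert (t = c sN) as -> by (rewrite E, (image _ _ HsN) in Ht; congruence); eauto.
Qed.

Section Destutter.

Variables (S T : Type) (edge : T -> T -> Prop) (final : T -> Prop).
Variables (p : sequence S) (c : S -> T).

Hypothesis edge_irrefl : forall t, ~ edge t t.
Hypothesis p_nonempty : occurs p 0.
Hypothesis p_closed : forall n, occurs p (1 + n) -> occurs p n.
Hypothesis p_step : forall n s t, p n = Some s -> p (1 + n) = Some t ->
  c s = c t /\ final (c s) \/ edge (c s) (c t).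
Hypothesis p_end : forall n s, p n = Some s -> p (1 + n) = None -> final (c s).

Fixpoint moves (n : nat) : nat :=
  match n with
  | 0 => 0
  | Datatypes.S m =>
      if excluded_middle_informative (option_map c (p m) = option_map c (p n))
      then moves m else 1 + moves m
  end.

Lemma moves_step (n : nat) :
  moves (1 + n) = moves n /\ option_map c (p n) = option_map c (p (1 + n)) \/
  moves (1 + n) = 1 + moves n /\ option_map c (p n) <> option_map c (p (1 + n)).
Proof. cbn [moves Nat.add]; destruct excluded_middle_informative; auto. Qed.

Lemma moves_slow : slow moves.
Proof. intros n; destruct (moves_step n); tauto. Qed.

Lemma moves_stutter (n m : nat) : n <= m -> moves n = moves m ->
  option_map c (p n) = option_map c (p m).
Proof.
intros L; induction L as [|m L IH]; intros E; [reflexivity|].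
assert (mono := slow_mono moves_slow L).
destruct (moves_step m) as [[K K']|[K _]]; cbn [Nat.add] in K; [|lia].
etransitivity; [apply IH; lia|exact K'].
Qed.

Lemma moves_jump (m n : nat) : moves n = 1 + m ->
  exists k, moves k = m /\ moves (1 + k) = 1 + m.
Proof.
induction n as [|n IH]; intros E; [discriminate|].
destruct (moves_slow n) as [K|K]; cbn [Nat.add] in K.
- apply IH; congruence.
- exists n; split; [lia|exact E].
Qed.

Definition destuttered (m : nat) : option T :=
  match excluded_middle_informative (exists n, moves n = m) with
  | left H => option_map c (p (proj1_sig (constructive_indefinite_description _ H)))
  | right _ => None
  end.

Lemma destuttered_moves (n : nat) : destuttered (moves n) = option_map c (p n).
Proof.
unfold destuttered; destruct excluded_middle_informative as [H|H]; [|exfalso; eauto].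
destruct constructive_indefinite_description as [k E]; simpl.
destruct (PeanoNat.Nat.le_ge_cases k n); [|symmetry]; now apply moves_stutter.
Qed.

Lemma occurs_destuttered (m : nat) :
  occurs destuttered m -> exists n s, moves n = m /\ p n = Some s.
Proof.
intros Hm; assert (E : exists n, moves n = m).
{ unfold occurs, destuttered in Hm; now destruct excluded_middle_informative. }
destruct E as [n <-]; exists n; unfold occurs in Hm; rewrite destuttered_moves in Hm.
destruct (p n) as [s|]; [eauto|now destruct Hm].
Qed.

Lemma destuttered_jump (m : nat) : occurs destuttered (1 + m) ->
  exists s t, destuttered m = Some (c s) /\ destuttered (1 + m) = Some (c t) /\
    edge (c s) (c t).
Proof.
intros Hm; destruct (occurs_destuttered Hm) as (n & _ & E & _).
destruct (moves_jump E) as (k & <- & Ek1).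
rewrite <- Ek1 in Hm |- *; unfold occurs in Hm; rewrite !destuttered_moves in *.
destruct (p (1 + k)) as [t|] eqn:Ht; [|now destruct Hm].
destruct (proj1 (occurs_iff p k)) as [s Hs]; [apply p_closed, occurs_iff; eauto|].
exists s, t; rewrite Hs; repeat split; auto.
destruct (p_step Hs Ht) as [[E' _]|]; auto.
destruct (moves_step k) as [[K _]|[_ N]]; [lia|].
rewrite Hs, Ht in N; simpl in N; congruence.
Qed.

Lemma destuttered_path : is_path edge final destuttered.
Proof.
repeat split.
- change (destuttered (moves 0) <> None); rewrite destuttered_moves.
  apply occurs_iff in p_nonempty; destruct p_nonempty as [s ->]; discriminate.
- intros m Hm; destruct (destuttered_jump Hm) as (s & t & E & _); apply occurs_iff; eauto.
- intros m s' t' Hs' Ht'; destruct (@destuttered_jump m) as (s & t & Es & Et & K);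
    [apply occurs_iff; eauto|congruence].
- intros m s' Hs' Hm.
  destruct (@occurs_destuttered m) as (n & s & <- & Hs); [apply occurs_iff; eauto|].
  rewrite destuttered_moves, Hs in Hs'; injection Hs' as <-.
  destruct (p (1 + n)) as [t|] eqn:Ht; [|now apply (p_end Hs)].
  destruct (p_step Hs Ht) as [[_ F]|K]; auto.
  destruct (moves_step n) as [[_ E]|[E _]].
  + rewrite Hs, Ht in E; injection E as E; rewrite E in K; now destruct (edge_irrefl K).
  + rewrite <- E, destuttered_moves, Ht in Hm; discriminate.
Qed.

Lemma destutter : exists q, is_path edge final q /\ stutter_image c p q.
Proof.
exists destuttered; split; [exact destuttered_path|].
exists moves; split; [split; [reflexivity|split; [exact moves_slow|]]|].
- intros m Hm; destruct (occurs_destuttered Hm) as (n & s & E & Hs).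
  exists n; split; auto; apply occurs_iff; eauto.
- intros n s Hs; now rewrite destuttered_moves, Hs.
Qed.

End Destutter.
Section ABC.

Variables A B C : Type.
Variable defn : A -> expr A B C.

Local Notation act := (act B C).
Local Notation deriv := (deriv A B C).
Local Notation expr := (expr A B C).
Local Notation hset := (hset C).
Local Notation ustate := (ustate A B C).
Local Notation sstate := (sstate A B C).
Local Notation is_derivation := (is_derivation defn).
Local Notation eqd_dom := (eqd_dom defn).
Local Notation eqd := (eqd defn).
Local Notation conc := (conc defn).
Local Notation uedge := (uedge defn).
Local Notation is_upath := (is_upath defn).
Local Notation is_spath := (is_spath defn).

(** * Derivations *)

Definition broadcast (a1 a2 : act) : Prop :=
  exists b, a1 = Bro C b Snd /\ a2 = Bro C b Rcv.

Definition complementary (a1 a2 : act) : Prop :=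
  exists h, a1 = Hs B h /\ a2 = Hs B (bar h).

Lemma is_receive_Bro (b : B) (s : sharp) : is_receive (Bro C b s) <-> s = Rcv.
Proof. split; [intros [b' E]; congruence|intros ->; now exists b]. Qed.

Lemma is_receive_rel_act (f : relabelling B C) (a : act) :
  is_receive (rel_act f a) <-> is_receive a.
Proof.
destruct a as [b s|h|]; simpl; [now rewrite !is_receive_Bro|split; intros [b E]; discriminate..].
Qed.

Lemma broadcast_receive (a1 a2 : act) : broadcast a1 a2 -> ~ is_receive a1 /\ is_receive a2.
Proof. intros (b & -> & ->); rewrite !is_receive_Bro; split; [discriminate|reflexivity]. Qed.

Lemma complementary_not_receive (a1 a2 : act) :
  complementary a1 a2 -> ~ is_receive a1 /\ ~ is_receive a2.
Proof. intros (h & -> & ->); split; intros [b E]; discriminate. Qed.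

Definition unheard (a : act) (Q : expr) : Prop :=
  match a with Bro _ b _ => ~ can_receive defn Q b | _ => True end.

Definition syncs (a1 a2 : act) : Prop :=
  match a1, a2 with
  | Hs _ h1, Hs _ h2 => h2 = bar h1
  | Bro _ b1 s1, Bro _ b2 s2 => b2 = b1 /\ sharp_comp s1 s2 <> None
  | _, _ => False
  end.

Fixpoint valid (x : deriv) : Prop :=
  match x with
  | DAct _ _ => True
  | DPar x y => valid x /\ valid y /\ syncs (label x) (label y)
  | DParL x Q => valid x /\ unheard (label x) Q
  | DParR P y => valid y /\ unheard (label y) P
  | DSumL x _ | DSumR _ x | DRel x _ => valid x
  | DRes x c => valid x /\ label x <> Hs B c /\ label x <> Hs B (bar c)
  | DRec X x => valid x /\ src x = defn X
  end.

Lemma valid_derives (x : deriv) : valid x -> derives defn x (src x) (label x) (target x).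
Proof.
unfold derives; induction x as [a P|x IHx y IHy|x IH Q|P y IH|x IH Q|P x IH|x IH f|x IH c|X x IH];
  simpl; intros V.
- constructor.
- destruct V as (Vx & Vy & S); specialize (IHx Vx); specialize (IHy Vy).
  destruct (label x) as [b s|h|], (label y) as [b' s'|h'|]; simpl in S; try contradiction.
  + destruct S as [-> S]; destruct (sharp_comp s s') as [s0|] eqn:E; [|congruence].
    eapply R_BroC; eauto.
  + subst h'; eapply R_Comm; eauto.
- destruct V as [V U]; specialize (IH V).
  destruct (label x); simpl in U; [apply R_BroL|apply R_ParL|apply R_ParL]; simpl; auto.
- destruct V as [V U]; specialize (IH V).
  destruct (label y); simpl in U; [apply R_BroR|apply R_ParR|apply R_ParR]; simpl; auto.
- now apply R_SumL, IH.
- now apply R_SumR, IH.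
- now apply R_Rel, IH.
- now apply R_Res; [apply IH| |].
- destruct V as [V E]; apply R_Rec; rewrite <- E; auto.
Qed.

Lemma derives_valid (x : deriv) (P : expr) (a : act) (Q : expr) : derives defn x P a Q -> valid x.
Proof.
intros D; unfold derives in D; induction D; simpl; auto;
  repeat match goal with
    | D : derives_wrt _ _ _ _ _ _ |- _ =>
        apply derives_src_label_target in D; destruct D as (? & D & ?)
  end;
  repeat match goal with D : label _ = _ |- _ => rewrite D end; simpl; auto.
- destruct a; simpl in *; tauto.
- destruct a; simpl in *; tauto.
- repeat split; auto; congruence.
Qed.

Lemma is_derivation_iff (x : deriv) : is_derivation x <-> valid x.
Proof.
split.
- intros (P & a & Q & D); exact (derives_valid D).
- intros V; do 3 eexists; exact (valid_derives V).
Qed.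

Lemma transition_iff (P : expr) (a : act) (Q : expr) :
  transition defn P a Q <-> exists x, valid x /\ src x = P /\ label x = a /\ target x = Q.
Proof.
split; intros [x D]; exists x.
- split; [exact (derives_valid D)|exact (derives_src_label_target D)].
- destruct D as (V & <- & <- & <-); now apply valid_derives.
Qed.

Lemma eqd_dom_iff (x : deriv) : eqd_dom x <-> valid x /\ ~ is_receive (label x).
Proof. unfold Defs.eqd_dom; now rewrite is_derivation_iff. Qed.

Lemma eqd_dom_Par (x y : deriv) : eqd_dom (DPar x y) <-> valid x /\ valid y /\
  (broadcast (label x) (label y) \/ broadcast (label y) (label x) \/
   complementary (label x) (label y)).
Proof.
rewrite eqd_dom_iff; simpl; split.
- intros [(Vx & Vy & S) N]; split; [exact Vx|split; [exact Vy|]].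
  destruct (label x) as [b s|h|], (label y) as [b' s'|h'|]; simpl in S; try contradiction.
  + destruct S as [-> S], s, s'; simpl in S, N; try now destruct S.
    * left; now exists b.
    * right; left; now exists b.
    * destruct N; now exists b.
  + right; right; exists h; now rewrite S.
- intros (Vx & Vy & [(b & -> & ->)|[(b & -> & ->)|(h & -> & ->)]]); simpl;
    (split; [repeat split; auto; discriminate|intros [b' E]; discriminate]).
Qed.

Lemma unheard_Nil (a : act) : unheard a Nil.
Proof. destruct a; simpl; auto; intros H; inversion H. Qed.

Lemma eqd_dom_ParL_Nil (x : deriv) : eqd_dom (DParL x Nil) <-> eqd_dom x.
Proof. rewrite !eqd_dom_iff; simpl; intuition auto using unheard_Nil. Qed.

Lemma eqd_dom_ParR_Nil (x : deriv) : eqd_dom (DParR Nil x) <-> eqd_dom x.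
Proof. rewrite !eqd_dom_iff; simpl; intuition auto using unheard_Nil. Qed.

Lemma eqd_doms (x y : deriv) : eqd x y -> eqd_dom x /\ eqd_dom y.
Proof. intros H; induction H; tauto. Qed.

(** * Canonical representatives *)

Fixpoint canon (x : deriv) : deriv :=
  match x with
  | DAct a P => DAct a P
  | DPar x y =>
      match label y with
      | Bro _ _ Snd => DParR Nil (canon y)
      | Bro _ _ Rcv => DParL (canon x) Nil
      | _ => DPar (canon x) (canon y)
      end
  | DParL x _ => DParL (canon x) Nil
  | DParR _ y => DParR Nil (canon y)
  | DSumL x _ | DSumR _ x | DRec _ x => canon x
  | DRel x f => DRel (canon x) f
  | DRes x c => DRes (canon x) c
  end.

Lemma canon_broadcast_l (x y : deriv) :
  broadcast (label x) (label y) -> canon (DPar x y) = DParL (canon x) Nil.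
Proof. intros (b & _ & E); simpl; now rewrite E. Qed.

Lemma canon_broadcast_r (x y : deriv) :
  broadcast (label y) (label x) -> canon (DPar x y) = DParR Nil (canon y).
Proof. intros (b & E & _); simpl; now rewrite E. Qed.

Lemma canon_complementary (x y : deriv) :
  complementary (label x) (label y) -> canon (DPar x y) = DPar (canon x) (canon y).
Proof. intros (h & _ & E); simpl; now rewrite E. Qed.

Lemma valid_label_canon (x : deriv) : valid x -> valid (canon x) /\ label (canon x) = label x.
Proof.
induction x as [a P|x IHx y IHy|x IH Q|P y IH|x IH Q|P x IH|x IH f|x IH c|X x IH];
  simpl; intros V; auto.
- destruct V as (Vx & Vy & S); destruct (IHx Vx) as [Wx Lx], (IHy Vy) as [Wy Ly].
  destruct (label x) as [b s|h|], (label y) as [b' s'|h'|]; simpl in S; try contradiction.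
  + destruct S as [-> S]; destruct s, s'; simpl in *; try congruence;
      rewrite ?Lx, ?Ly; repeat split; auto using unheard_Nil.
  + simpl; rewrite Lx, Ly; simpl; auto.
- destruct (IH (proj1 V)); simpl; auto using unheard_Nil.
- destruct (IH (proj1 V)); simpl; auto using unheard_Nil.
- destruct (IH V) as [W ->]; auto.
- destruct (IH (proj1 V)) as [W ->]; tauto.
- destruct (IH (proj1 V)); auto.
Qed.

Lemma label_canon (x : deriv) : valid x -> label (canon x) = label x.
Proof. apply valid_label_canon. Qed.

Lemma eqd_dom_canon (x : deriv) : eqd_dom x -> eqd_dom (canon x).
Proof.
rewrite !eqd_dom_iff; intros [V N]; destruct (valid_label_canon V) as [W ->]; auto.
Qed.

Lemma eqd_same_canon (x y : deriv) : eqd x y -> canon x = canon y.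
Proof.
intros H; induction H
  as [| | | | |x s P [b Lx] D _|x s P [b Lx] D _| | | | | | | |x y s z H IH H' IH' _ _];
  simpl; try congruence.
- apply eqd_dom_iff in D; destruct D as [(_ & _ & S) _]; rewrite Lx in S.
  destruct (label s) as [b' []|h|]; simpl in S; tauto.
- now rewrite Lx.
- apply eqd_doms in H'; destruct H' as [Ds Dz]; rewrite eqd_dom_iff in Ds, Dz.
  now rewrite <- (label_canon (proj1 Ds)), <- (label_canon (proj1 Dz)), IH, IH'.
Qed.

Lemma eqd_ParL_Nil (x y : deriv) : eqd x y -> eqd (DParL x Nil) (DParL y Nil).
Proof. intros H; apply eqd_ParL; auto; apply eqd_dom_ParL_Nil, (eqd_doms H). Qed.

Lemma eqd_ParR_Nil (x y : deriv) : eqd x y -> eqd (DParR Nil x) (DParR Nil y).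
Proof. intros H; apply eqd_ParR; auto; apply eqd_dom_ParR_Nil, (eqd_doms H). Qed.

Lemma eqd_canon_Par (x y : deriv) :
  (eqd_dom x -> eqd x (canon x)) -> (eqd_dom y -> eqd y (canon y)) ->
  eqd_dom (DPar x y) -> eqd (DPar x y) (canon (DPar x y)).
Proof.
intros IHx IHy D; assert (D' := eqd_dom_canon D).
destruct (proj1 (eqd_dom_Par x y) D) as (Vx & Vy & [K|[K|K]]).
- rewrite (canon_broadcast_l K).
  assert (Dx : eqd_dom x) by (apply eqd_dom_iff; split; [exact Vx|apply (broadcast_receive K)]).
  apply eqd_trans with (DParL x Nil); [|now apply eqd_ParL_Nil, IHx].
  apply eqd_sendL; auto; [|now apply eqd_dom_ParL_Nil].
  destruct K as (b & Lx & _); now exists b.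
- rewrite (canon_broadcast_r K).
  assert (Dy : eqd_dom y) by (apply eqd_dom_iff; split; [exact Vy|apply (broadcast_receive K)]).
  apply eqd_trans with (DParR Nil y); [|now apply eqd_ParR_Nil, IHy].
  apply eqd_sendR; auto; [|now apply eqd_dom_ParR_Nil].
  destruct K as (b & Ly & _); now exists b.
- rewrite (canon_complementary K) in *; destruct (complementary_not_receive K).
  apply eqd_Par; auto; [apply IHx|apply IHy]; now apply eqd_dom_iff.
Qed.

Lemma eqd_canon (x : deriv) : eqd_dom x -> eqd x (canon x).
Proof.
induction x as [a P|x IHx y IHy|x IH Q|P y IH|x IH Q|P x IH|x IH f|x IH c|X x IH]; intros D;
  assert (D' := eqd_dom_canon D); assert (VN := proj1 (eqd_dom_iff _) D); simpl in D', VN |- *.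
- now apply eqd_refl.
- now apply eqd_canon_Par.
- assert (Dx : eqd_dom x) by (apply eqd_dom_iff; tauto).
  apply eqd_trans with (DParL x Nil); [|now apply eqd_ParL_Nil, IH].
  apply eqd_ParL_ctx; auto; now apply eqd_dom_ParL_Nil.
- assert (Dy : eqd_dom y) by (apply eqd_dom_iff; tauto).
  apply eqd_trans with (DParR Nil y); [|now apply eqd_ParR_Nil, IH].
  apply eqd_ParR_ctx; auto; now apply eqd_dom_ParR_Nil.
- apply eqd_trans with x; [apply eqd_SumL|apply IH]; now apply eqd_dom_iff.
- apply eqd_trans with x; [apply eqd_sym, eqd_SumR|apply IH]; now apply eqd_dom_iff.
- rewrite is_receive_rel_act in VN; apply eqd_Rel; auto; apply IH; now apply eqd_dom_iff.
- apply eqd_Res; auto; apply IH, eqd_dom_iff; tauto.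
- assert (Dx : eqd_dom x) by (apply eqd_dom_iff; tauto).
  apply eqd_trans with x; [now apply eqd_Rec|now apply IH].
Qed.

Lemma eqd_iff_canon (x y : deriv) :
  eqd x y <-> eqd_dom x /\ eqd_dom y /\ canon x = canon y.
Proof.
split.
- intros H; assert (E := eqd_same_canon H); apply eqd_doms in H; tauto.
- intros (Dx & Dy & E); apply eqd_trans with (canon x); [now apply eqd_canon|].
  rewrite E; now apply eqd_sym, eqd_canon.
Qed.

(** * Restriction and relabelling *)

Inductive unary_op : Type :=
| Restrict (c : hs C)
| Relabel (f : relabelling B C).

Definition op_expr (o : unary_op) (P : expr) : expr :=
  match o with Restrict c => Res P c | Relabel f => Rel P f end.

Definition op_deriv (o : unary_op) (x : deriv) : deriv :=
  match o with Restrict c => DRes x c | Relabel f => DRel x f end.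

Definition op_act (o : unary_op) (a : act) : act :=
  match o with Restrict _ => a | Relabel f => rel_act f a end.

Definition op_allows (o : unary_op) (a : act) : Prop :=
  match o with Restrict c => a <> Hs B c /\ a <> Hs B (bar c) | Relabel _ => True end.

Lemma src_op (o : unary_op) (x : deriv) : src (op_deriv o x) = op_expr o (src x).
Proof. now destruct o. Qed.

Lemma target_op (o : unary_op) (x : deriv) : target (op_deriv o x) = op_expr o (target x).
Proof. now destruct o. Qed.

Lemma label_op (o : unary_op) (x : deriv) : label (op_deriv o x) = op_act o (label x).
Proof. now destruct o. Qed.

Lemma canon_op (o : unary_op) (x : deriv) : canon (op_deriv o x) = op_deriv o (canon x).
Proof. now destruct o. Qed.

Lemma op_expr_inj (o : unary_op) (P Q : expr) : op_expr o P = op_expr o Q -> P = Q.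
Proof. destruct o; simpl; congruence. Qed.

Lemma op_deriv_inj (o : unary_op) (x y : deriv) : op_deriv o x = op_deriv o y -> x = y.
Proof. destruct o; simpl; congruence. Qed.

Lemma src_op_inv (o : unary_op) (x : deriv) (P : expr) :
  src x = op_expr o P -> exists y, x = op_deriv o y.
Proof.
destruct o, x; simpl; intros E; try discriminate E; injection E as E1 E2; subst; eauto.
Qed.

Lemma valid_op (o : unary_op) (x : deriv) :
  valid (op_deriv o x) <-> valid x /\ op_allows o (label x).
Proof. destruct o; simpl; tauto. Qed.

Lemma eqd_dom_op (o : unary_op) (x : deriv) :
  eqd_dom (op_deriv o x) <-> eqd_dom x /\ op_allows o (label x).
Proof.
rewrite !eqd_dom_iff, valid_op; destruct o; simpl; rewrite ?is_receive_rel_act; tauto.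
Qed.

Lemma conc_op (o : unary_op) (x y : deriv) :
  valid (op_deriv o x) -> valid (op_deriv o y) ->
  conc (op_deriv o x) (op_deriv o y) <-> conc x y.
Proof.
rewrite <- !is_derivation_iff; destruct o; simpl; intros Vx Vy; split; intros H;
  try (inversion H; assumption); [now apply conc_Res|now apply conc_Rel].
Qed.

Lemma conc_op_inv (o : unary_op) (x y : deriv) :
  conc x (op_deriv o y) -> exists z, x = op_deriv o z /\ conc z y.
Proof. destruct o; simpl; intros H; inversion H; eauto. Qed.

(** * Concurrency and enabledness *)

Definition source (u : ustate) : expr :=
  match u with UExpr P => P | UDeriv z => src z end.

Definition valid_state (u : ustate) : Prop :=
  match u with UExpr _ => True | UDeriv z => valid z end.

Definition ready (x : deriv) (u : ustate) : Prop :=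
  match u with UExpr P => src x = P | UDeriv z => conc x z end.

Definition par_state (u v : ustate) : ustate :=
  match u, v with
  | UExpr P, UExpr Q => UExpr (Par P Q)
  | UDeriv x, UExpr Q => UDeriv (DParL x Q)
  | UExpr P, UDeriv y => UDeriv (DParR P y)
  | UDeriv x, UDeriv y => UDeriv (DPar x y)
  end.

Definition op_state (o : unary_op) (u : ustate) : ustate :=
  match u with UExpr P => UExpr (op_expr o P) | UDeriv x => UDeriv (op_deriv o x) end.

Lemma ready_op (o : unary_op) (x : deriv) (u : ustate) :
  valid (op_deriv o x) -> valid_state (op_state o u) -> ready x u ->
  ready (op_deriv o x) (op_state o u).
Proof.
destruct u as [P|z]; simpl; intros Vx Vz H.
- now rewrite src_op, H.
- now apply conc_op.
Qed.

Lemma ready_op_inv (o : unary_op) (x : deriv) (u : ustate) :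
  ready x (op_state o u) -> exists y, x = op_deriv o y /\ ready y u.
Proof.
destruct u as [P|z]; simpl; intros H; [|now apply conc_op_inv].
destruct (src_op_inv H) as [y ->]; exists y; split; [reflexivity|].
rewrite src_op in H; exact (op_expr_inj H).
Qed.

Lemma ready_par_inv (x : deriv) (u v : ustate) : ready x (par_state u v) ->
  (exists y Q, x = DParL y Q /\ ready y u) \/
  (exists P z, x = DParR P z /\ ready z v) \/
  (exists y z, x = DPar y z /\ (ready y u \/ is_receive (label y)) /\
     (ready z v \/ is_receive (label z))).
Proof.
destruct u as [P|u], v as [Q|v]; simpl; intros H;
  [destruct x; try discriminate H; injection H as <- <-|inversion H; subst..];
  eauto 10.
Qed.

Lemma ready_ParL (x : deriv) (u v : ustate) :
  valid (DParL x (source v)) -> valid_state (par_state u v) -> ready x u ->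
  ready (DParL x (source v)) (par_state u v).
Proof.
rewrite <- is_derivation_iff; destruct u as [P|u], v as [Q|v];
  cbn [par_state valid_state source ready]; intros Dx Vu H;
  try apply is_derivation_iff in Vu; [simpl; congruence|..];
  auto using conc_lr, conc_ParL, conc_ParL_Par.
Qed.

Lemma ready_ParR (y : deriv) (u v : ustate) :
  valid (DParR (source u) y) -> valid_state (par_state u v) -> ready y v ->
  ready (DParR (source u) y) (par_state u v).
Proof.
rewrite <- is_derivation_iff; destruct u as [P|u], v as [Q|v];
  cbn [par_state valid_state source ready]; intros Dy Vu H;
  try apply is_derivation_iff in Vu; [simpl; congruence|..];
  auto using conc_rl, conc_ParR, conc_ParR_Par.
Qed.

Lemma ready_Par (x y : deriv) (u v : ustate) :
  valid (DPar x y) -> valid_state (par_state u v) -> ready x u -> ready y v ->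
  ready (DPar x y) (par_state u v).
Proof.
rewrite <- is_derivation_iff; destruct u as [P|u], v as [Q|v];
  cbn [par_state valid_state source ready]; intros D Vu Hx Hy;
  try apply is_derivation_iff in Vu; [simpl; congruence|..];
  auto using conc_Par_ParR, conc_Par_ParL, conc_Par.
Qed.

Lemma ready_Par_receive_r (x y : deriv) (u v : ustate) :
  valid (DPar x y) -> valid_state (par_state u v) -> ready x u ->
  is_receive (label y) -> src y = source v -> ready (DPar x y) (par_state u v).
Proof.
rewrite <- is_derivation_iff; destruct u as [P|u], v as [Q|v];
  cbn [par_state valid_state source ready]; intros D Vu Hx Ry Sy;
  try apply is_derivation_iff in Vu; [simpl; congruence|..];
  auto using conc_recv_r, conc_Par_ParL, conc_Par_recv_r.
Qed.

Lemma ready_Par_receive_l (x y : deriv) (u v : ustate) :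
  valid (DPar x y) -> valid_state (par_state u v) -> ready y v ->
  is_receive (label x) -> src x = source u -> ready (DPar x y) (par_state u v).
Proof.
rewrite <- is_derivation_iff; destruct u as [P|u], v as [Q|v];
  cbn [par_state valid_state source ready]; intros D Vu Hy Rx Sx;
  try apply is_derivation_iff in Vu; [simpl; congruence|..];
  auto using conc_recv_l, conc_Par_ParR, conc_Par_recv_l.
Qed.

Definition canon_enabled (t : deriv) (u : ustate) : Prop :=
  exists x, eqd_dom x /\ canon x = t /\ ready x u.

Lemma canon_enabled_intro (x : deriv) (u : ustate) :
  eqd_dom x -> ready x u -> canon_enabled (canon x) u.
Proof. now exists x. Qed.

(* [Nil], because canonical representatives forget the idle component. *)
Inductive par_event (L R : deriv -> Prop) : deriv -> Prop :=
| par_event_l t : L t -> par_event L R (DParL t Nil)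
| par_event_r t : R t -> par_event L R (DParR Nil t)
| par_event_sync t1 t2 : L t1 -> R t2 -> complementary (label t1) (label t2) ->
    par_event L R (DPar t1 t2).

Lemma canon_enabled_par_inv (t : deriv) (u v : ustate) : canon_enabled t (par_state u v) ->
  par_event (fun t1 => canon_enabled t1 u) (fun t2 => canon_enabled t2 v) t.
Proof.
intros (x & D & <- & H).
destruct (ready_par_inv H) as [(y & Q & -> & Hy)|[(P & z & -> & Hz)|(y & z & -> & Hy & Hz)]].
- apply par_event_l, canon_enabled_intro; auto.
  rewrite eqd_dom_iff in *; simpl in D; tauto.
- apply par_event_r, canon_enabled_intro; auto.
  rewrite eqd_dom_iff in *; simpl in D; tauto.
- apply eqd_dom_Par in D; destruct D as (Vy & Vz & [K|[K|K]]).
  + rewrite (canon_broadcast_l K); apply broadcast_receive in K.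
    apply par_event_l, canon_enabled_intro; [apply eqd_dom_iff|]; tauto.
  + rewrite (canon_broadcast_r K); apply broadcast_receive in K.
    apply par_event_r, canon_enabled_intro; [apply eqd_dom_iff|]; tauto.
  + rewrite (canon_complementary K); assert (N := complementary_not_receive K).
    apply par_event_sync; [apply canon_enabled_intro..|now rewrite !label_canon];
      try apply eqd_dom_iff; tauto.
Qed.

Lemma canon_enabled_op_inv (o : unary_op) (t : deriv) (u : ustate) :
  canon_enabled t (op_state o u) ->
  exists t1, t = op_deriv o t1 /\ op_allows o (label t1) /\ canon_enabled t1 u.
Proof.
intros (x & D & <- & H); destruct (ready_op_inv H) as (y & -> & Hy).
apply eqd_dom_op in D; destruct D as [D allows].
exists (canon y); rewrite canon_op, label_canon by (now apply eqd_dom_iff in D).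
auto using canon_enabled_intro.
Qed.

Lemma canon_enabled_op (o : unary_op) (t : deriv) (u : ustate) : valid_state (op_state o u) ->
  canon_enabled t (op_state o u) <->
  exists t1, t = op_deriv o t1 /\ op_allows o (label t1) /\ canon_enabled t1 u.
Proof.
intros V; split; [apply canon_enabled_op_inv|].
intros (_ & -> & allows & x & D & <- & H).
rewrite label_canon in allows by (now apply eqd_dom_iff in D).
assert (D' : eqd_dom (op_deriv o x)) by now apply eqd_dom_op.
rewrite <- canon_op; apply canon_enabled_intro; auto.
apply ready_op; auto; now apply eqd_dom_iff in D'.
Qed.

(* This is why FG en(nu) and GF nu exclude each other. *)
Lemma not_enabled_while_occurring (z : deriv) : ~ canon_enabled (canon z) (UDeriv z).
Proof.
induction z as [a P|y IHy z IHz|y IH Q|P z IH|z IH Q|P z IH|z IH f|z IH c|X z IH];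
  intros H.
- destruct H as (x & _ & _ & K); inversion K.
- apply (@canon_enabled_par_inv _ (UDeriv y) (UDeriv z)) in H; simpl in H.
  destruct (label z) as [b []|h|]; inversion H; subst; auto.
- apply (@canon_enabled_par_inv _ (UDeriv y) (UExpr Q)) in H; inversion H; auto.
- apply (@canon_enabled_par_inv _ (UExpr P) (UDeriv z)) in H; inversion H; auto.
- apply IH; destruct H as (x & D & E & K); inversion K; subst.
  eexists; split; [|split; [|eassumption]]; auto.
  apply eqd_dom_iff in D; now apply eqd_dom_iff.
- apply IH; destruct H as (x & D & E & K); inversion K; subst.
  eexists; split; [|split; [|eassumption]]; auto.
  apply eqd_dom_iff in D; now apply eqd_dom_iff.
- apply (@canon_enabled_op_inv (Relabel f) _ (UDeriv z)) in H.
  destruct H as (t & E & _ & K); injection E as <-; auto.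
- apply (@canon_enabled_op_inv (Restrict c) _ (UDeriv z)) in H.
  destruct H as (t & E & _ & K); injection E as <-; auto.
- apply IH; destruct H as (x & D & E & K); inversion K; subst.
  eexists; split; [|split; [|eassumption]]; auto.
  apply eqd_dom_iff in D; apply eqd_dom_iff; simpl in D; tauto.
Qed.

Hypothesis guarded_defn : forall X, guarded (defn X).

Lemma unheard_or_broadcast (x : deriv) (Q : expr) : ~ is_receive (label x) ->
  unheard (label x) Q \/
  exists y, valid y /\ src y = Q /\ broadcast (label x) (label y).
Proof.
intros N; destruct (label x) as [b s|h|]; [|now left..].
assert (s = Snd) as -> by (destruct s; auto; destruct N; now exists b).
destruct (classic (can_receive defn Q b)) as [R|R]; [right|now left].
apply (can_receive_coherent guarded_defn) in R; destruct R as (y & Q' & D); exists y.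
destruct (derives_src_label_target D) as (E & L & _).
split; [exact (derives_valid D)|split; [exact E|now exists b]].
Qed.

Lemma canon_enabled_ParL (t : deriv) (u v : ustate) :
  valid_state (par_state u v) -> canon_enabled t u -> canon_enabled (DParL t Nil) (par_state u v).
Proof.
intros Vu (x & D & <- & H); apply eqd_dom_iff in D; destruct D as [V N].
destruct (unheard_or_broadcast (source v) N) as [U|(y & Vy & Sy & K)].
- assert (V' : valid (DParL x (source v))) by now split.
  apply (@canon_enabled_intro (DParL x (source v))); [now apply eqd_dom_iff|now apply ready_ParL].
- assert (D' : eqd_dom (DPar x y)) by (apply eqd_dom_Par; auto).
  rewrite <- (canon_broadcast_l K); apply canon_enabled_intro; auto.
  apply eqd_dom_iff in D'; apply ready_Par_receive_r; try apply (broadcast_receive K); tauto.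
Qed.

Lemma canon_enabled_ParR (t : deriv) (u v : ustate) :
  valid_state (par_state u v) -> canon_enabled t v -> canon_enabled (DParR Nil t) (par_state u v).
Proof.
intros Vu (y & D & <- & H); apply eqd_dom_iff in D; destruct D as [V N].
destruct (unheard_or_broadcast (source u) N) as [U|(x & Vx & Sx & K)].
- assert (V' : valid (DParR (source u) y)) by now split.
  apply (@canon_enabled_intro (DParR (source u) y)); [now apply eqd_dom_iff|now apply ready_ParR].
- assert (D' : eqd_dom (DPar x y)) by (apply eqd_dom_Par; auto).
  rewrite <- (canon_broadcast_r K); apply canon_enabled_intro; auto.
  apply eqd_dom_iff in D'; apply ready_Par_receive_l; try apply (broadcast_receive K); tauto.
Qed.

Lemma canon_enabled_par (t : deriv) (u v : ustate) : valid_state (par_state u v) ->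
  canon_enabled t (par_state u v) <->
  par_event (fun t1 => canon_enabled t1 u) (fun t2 => canon_enabled t2 v) t.
Proof.
intros Vu; split; [apply canon_enabled_par_inv|].
intros H; destruct H as [t H|t H|t1 t2 H1 H2 K].
- now apply canon_enabled_ParL.
- now apply canon_enabled_ParR.
- destruct H1 as (x & Dx & <- & Hx), H2 as (y & Dy & <- & Hy).
  apply eqd_dom_iff in Dx, Dy; rewrite !label_canon in K by tauto.
  assert (D : eqd_dom (DPar x y)) by (apply eqd_dom_Par; tauto).
  rewrite <- (canon_complementary K); apply canon_enabled_intro; auto.
  apply ready_Par; auto; now apply eqd_dom_iff in D.
Qed.

(** * Persistence and fairness *)

Lemma upath_valid (q : sequence ustate) : is_upath q ->
  forall n u, q n = Some u -> valid_state u.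
Proof.
intros (_ & _ & edges & ends) n u Hu; destruct u as [P|x]; simpl; auto.
destruct (q (1 + n)) as [v|] eqn:Hv.
- assert (E := edges _ _ _ Hu Hv); inversion E; subst; now apply is_derivation_iff.
- destruct (ends _ _ Hu Hv); discriminate.
Qed.

Definition left_state (u : ustate) : ustate :=
  match u with
  | UExpr (Par P _) | UDeriv (DParR P _) => UExpr P
  | UDeriv (DPar x _) | UDeriv (DParL x _) => UDeriv x
  | _ => u
  end.

Definition right_state (u : ustate) : ustate :=
  match u with
  | UExpr (Par _ Q) | UDeriv (DParL _ Q) => UExpr Q
  | UDeriv (DPar _ y) | UDeriv (DParR _ y) => UDeriv y
  | _ => u
  end.

Lemma left_par_state (u v : ustate) : left_state (par_state u v) = u.
Proof. now destruct u, v. Qed.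

Lemma right_par_state (u v : ustate) : right_state (par_state u v) = v.
Proof. now destruct u, v. Qed.

Definition par_composition (q q1 q2 : sequence ustate) : Prop :=
  (forall n u, q n = Some u -> u = par_state (left_state u) (right_state u)) /\
  stutter_image left_state q q1 /\ stutter_image right_state q q2.

Definition persistent (t : deriv) (q : sequence ustate) : Prop :=
  eventually_always (canon_enabled t) q.

Lemma persistent_par (t : deriv) (q q1 q2 : sequence ustate) :
  is_upath q -> par_composition q q1 q2 ->
  persistent t q <-> par_event (fun t1 => persistent t1 q1) (fun t2 => persistent t2 q2) t.
Proof.
intros Hq (par & image1 & image2); unfold persistent.
assert (en : forall n u t', q n = Some u -> canon_enabled t' u <->
  par_event (fun t1 => canon_enabled t1 (left_state u))
    (fun t2 => canon_enabled t2 (right_state u)) t').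
{ intros n u t' Hu; assert (V := upath_valid Hq Hu); rewrite (par _ _ Hu) in V.
  assert (K := canon_enabled_par t' V); now rewrite <- (par _ _ Hu) in K. }
assert (left := fun phi => eventually_always_stutter_image phi image1).
assert (right := fun phi => eventually_always_stutter_image phi image2).
split; intros H.
- destruct (eventually_always_somewhere H) as (n & u & Hu & K); apply (en _ _ _ Hu) in K.
  destruct K as [t1 _|t2 _|t1 t2 _ _ K];
    [apply par_event_l, left|apply par_event_r, right
    |apply par_event_sync; [apply left|apply right|exact K]];
    (eapply eventually_always_sub; [|exact H]); intros m v Hv Ev;
    apply (en _ _ _ Hv) in Ev; now inversion Ev.
- destruct H as [t1 H|t2 H|t1 t2 H1 H2 K].
  + apply left in H; eapply eventually_always_sub; [|exact H].
    intros n u Hu E; apply (en _ _ _ Hu); now apply par_event_l.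
  + apply right in H; eapply eventually_always_sub; [|exact H].
    intros n u Hu E; apply (en _ _ _ Hu); now apply par_event_r.
  + apply left in H1; apply right in H2.
    eapply eventually_always_sub; [|exact (eventually_always_and H1 H2)].
    intros n u Hu [E1 E2]; apply (en _ _ _ Hu); now apply par_event_sync.
Qed.

Lemma persistent_op (o : unary_op) (t : deriv) (q : sequence ustate) :
  is_upath (map_seq (op_state o) q) ->
  persistent t (map_seq (op_state o) q) <->
  exists t1, t = op_deriv o t1 /\ op_allows o (label t1) /\ persistent t1 q.
Proof.
intros Hq; unfold persistent; rewrite eventually_always_map.
assert (V : forall n u, q n = Some u -> valid_state (op_state o u)).
{ intros n u Hu; apply (upath_valid Hq (n := n)), map_seq_Some; eauto. }
split.
- intros H; destruct (eventually_always_somewhere H) as (n & u & Hu & K).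
  apply canon_enabled_op in K; [|exact (V _ _ Hu)]; destruct K as (t1 & -> & allows & _).
  exists t1; split; [reflexivity|split; [exact allows|]].
  apply (eventually_always_sub (p := q)) with (2 := H); intros m v Hv K.
  apply canon_enabled_op in K; [|exact (V _ _ Hv)]; destruct K as (t2 & E & _ & K).
  now rewrite (op_deriv_inj E).
- intros (t1 & -> & allows & H); apply (eventually_always_sub (p := q)) with (2 := H).
  intros n u Hu K; apply canon_enabled_op; [exact (V _ _ Hu)|eauto].
Qed.

Definition handshake_in (Y : hset) (a : act) : Prop := exists h, a = Hs B h /\ Y h.

Definition fair_at (Y : hset) (q : sequence ustate) (t : deriv) : Prop :=
  persistent t q -> handshake_in Y (label t).

Definition fair (Y : hset) (q : sequence ustate) : Prop := forall t, fair_at Y q t.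

Definition op_hset (o : unary_op) (Y : hset) : hset :=
  match o with
  | Restrict c => fun h => Y h \/ h = c \/ h = bar c
  | Relabel f => fun h => Y (rel_hs f h)
  end.

Lemma handshake_in_op (o : unary_op) (Y : hset) (a : act) :
  handshake_in (op_hset o Y) a <-> (op_allows o a -> handshake_in Y (op_act o a)).
Proof.
unfold handshake_in; destruct o as [c|f]; simpl; split.
- intros (h & -> & [Yh|[-> | ->]]) [N N']; [eauto|now destruct N|now destruct N'].
- intros H; destruct (classic (a = Hs B c)) as [->|N]; [eauto|].
  destruct (classic (a = Hs B (bar c))) as [->|N']; [eauto|].
  destruct (H (conj N N')) as (h & -> & Yh); eauto.
- intros (h & -> & Yh) _; now exists (rel_hs f h).
- intros H; destruct (H I) as (h & E & Yh); destruct a as [b s|k|]; try discriminate E.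
  injection E as <-; eauto.
Qed.

Lemma fair_par_components (Y : hset) (q q1 q2 : sequence ustate) :
  is_upath q -> par_composition q q1 q2 -> fair Y q ->
  exists X Z : hset, fair X q1 /\ fair Z q2 /\
    (forall h, X h \/ Z h -> Y h) /\ (forall h, ~ (X h /\ Z (bar h))).
Proof.
intros Hq comp F; assert (par := fun t => persistent_par t Hq comp).
assert (left : forall t, persistent t q1 -> handshake_in Y (label t)).
{ intros t H; apply (F (DParL t Nil)), par; now apply par_event_l. }
assert (right : forall t, persistent t q2 -> handshake_in Y (label t)).
{ intros t H; apply (F (DParR Nil t)), par; now apply par_event_r. }
exists (fun h => exists t, label t = Hs B h /\ persistent t q1),
  (fun h => exists t, label t = Hs B h /\ persistent t q2).
split; [|split; [|split]].
- intros t H; destruct (left t H) as (h & L & _); exists h; eauto.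
- intros t H; destruct (right t H) as (h & L & _); exists h; eauto.
- intros h [(t & L & H)|(t & L & H)].
  + destruct (left t H) as (h' & L' & Yh); congruence.
  + destruct (right t H) as (h' & L' & Yh); congruence.
- intros h [(t1 & L1 & H1) (t2 & L2 & H2)].
  destruct (F (DPar t1 t2)) as (h' & L & _).
  + apply par; apply par_event_sync; auto; now exists h.
  + simpl in L; rewrite L1 in L; discriminate.
Qed.

Lemma fair_op_operand (o : unary_op) (Y : hset) (q : sequence ustate) :
  is_upath (map_seq (op_state o) q) -> fair Y (map_seq (op_state o) q) ->
  fair (op_hset o Y) q.
Proof.
intros Hq F t H; apply handshake_in_op; intros allows; rewrite <- label_op.
apply F, persistent_op; eauto.
Qed.

(* Sums and recursion do not occur in canonical representatives. *)
Definition component (t' t : deriv) : Prop :=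
  match t with
  | DPar x y => t' = x \/ t' = y
  | DParL x _ | DParR _ x | DRes x _ | DRel x _ => t' = x
  | _ => False
  end.

Lemma fair_at_par (X Y Z : hset) (q q1 q2 : sequence ustate) (t : deriv) :
  is_upath q -> par_composition q q1 q2 ->
  (forall t', component t' t -> fair_at X q1 t') ->
  (forall t', component t' t -> fair_at Z q2 t') ->
  (forall h, X h \/ Z h -> Y h) -> (forall h, ~ (X h /\ Z (bar h))) ->
  fair_at Y q t.
Proof.
intros Hq comp F1 F2 sub disj H; apply (persistent_par t Hq comp) in H.
destruct H as [t1 H|t2 H|t1 t2 H1 H2 (h & L1 & L2)].
- destruct (F1 t1 eq_refl H) as (h & L & Xh); exists h; auto.
- destruct (F2 t2 eq_refl H) as (h & L & Zh); exists h; auto.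
- destruct (F1 t1 (or_introl eq_refl) H1) as (h1 & M1 & Xh).
  destruct (F2 t2 (or_intror eq_refl) H2) as (h2 & M2 & Zh).
  destruct (disj h); split; congruence.
Qed.

Lemma fair_at_op (o : unary_op) (Y : hset) (q : sequence ustate) (t : deriv) :
  is_upath (map_seq (op_state o) q) ->
  (forall t', component t' t -> fair_at (op_hset o Y) q t') ->
  fair_at Y (map_seq (op_state o) q) t.
Proof.
intros Hq F H; apply persistent_op in H; auto; destruct H as (t1 & -> & allows & H).
rewrite label_op; apply (proj1 (handshake_in_op o Y _)); auto.
apply F; auto; now destruct o.
Qed.

(** * Fair paths are just *)

Lemma hat_upath (q : sequence ustate) : is_upath q -> is_spath (hat_path q).
Proof.
apply map_seq_path.
- intros u v E; destruct E as [x D|x D]; constructor;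
    exists x; apply valid_derives; now apply is_derivation_iff.
- intros u [P ->]; now exists P.
Qed.

Lemma uedge_irrefl (u : ustate) : ~ uedge u u.
Proof. intros E; inversion E. Qed.

Definition idles_or_moves (u v : ustate) : Prop := u = v /\ ufinal u \/ uedge u v.

Lemma uedge_par (u1 u2 v : ustate) : uedge (par_state u1 u2) v ->
  exists v1 v2, v = par_state v1 v2 /\ idles_or_moves u1 v1 /\ idles_or_moves u2 v2.
Proof.
assert (out : forall x, valid x -> uedge (UExpr (src x)) (UDeriv x)).
{ intros x V; constructor; now apply is_derivation_iff. }
assert (into : forall x, valid x -> uedge (UDeriv x) (UExpr (target x))).
{ intros x V; constructor; now apply is_derivation_iff. }
assert (idle : forall P, idles_or_moves (UExpr P) (UExpr P)).
{ intros P; left; split; [reflexivity|now exists P]. }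
unfold idles_or_moves in *; intros E.
inversion E as [x D Eu Ev|x D Eu Ev]; apply is_derivation_iff in D.
- destruct u1 as [P|x1], u2 as [Q|x2]; try discriminate Eu.
  destruct x as [|x1 x2|x1 R|R x2| | | | |]; try discriminate Eu; injection Eu as <- <-; simpl in D.
  + exists (UDeriv x1), (UDeriv x2); intuition.
  + exists (UDeriv x1), (UExpr R); intuition.
  + exists (UExpr R), (UDeriv x2); intuition.
- destruct u1 as [P|x1], u2 as [Q|x2]; try discriminate Eu; injection Eu as ->; simpl in D.
  + exists (UExpr P), (UExpr (target x2)); intuition.
  + exists (UExpr (target x1)), (UExpr Q); intuition.
  + exists (UExpr (target x1)), (UExpr (target x2)); intuition.
Qed.

Lemma upath_par (q : sequence ustate) (P Q : expr) :
  is_upath q -> q 0 = Some (UExpr (Par P Q)) ->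
  exists q1 q2, is_upath q1 /\ is_upath q2 /\ par_composition q q1 q2.
Proof.
intros Hq H0.
assert (par : forall n u, q n = Some u -> u = par_state (left_state u) (right_state u)).
{ apply (path_invariant Hq H0); [reflexivity|].
  intros u v E Hu; rewrite Hu in E; destruct (uedge_par E) as (v1 & v2 & -> & _).
  now rewrite left_par_state, right_par_state. }
assert (step : forall n u v, q n = Some u -> q (1 + n) = Some v ->
  idles_or_moves (left_state u) (left_state v) /\
  idles_or_moves (right_state u) (right_state v)).
{ intros n u v Hu Hv; assert (E : uedge u v) by (apply Hq with n; auto).
  rewrite (par _ _ Hu) in E; destruct (uedge_par E) as (v1 & v2 & -> & K).
  now rewrite left_par_state, right_par_state. }
assert (last : forall n u, q n = Some u -> q (1 + n) = None ->
  ufinal (left_state u) /\ ufinal (right_state u)).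
{ intros n u Hu Hn; assert (K := par _ _ Hu).
  destruct Hq as (_ & _ & _ & ends), (ends _ _ Hu Hn) as [R ->].
  destruct R; try discriminate K; split; eexists; reflexivity. }
assert (nonempty := proj1 Hq); assert (closed := proj1 (proj2 Hq)).
destruct (destutter (edge := uedge) (final := @ufinal A B C) (p := q) (c := left_state))
  as (q1 & Hq1 & image1); auto using uedge_irrefl.
{ intros n u v Hu Hv; apply (step n u v Hu Hv). }
{ intros n u Hu Hn; apply (last n u Hu Hn). }
destruct (destutter (edge := uedge) (final := @ufinal A B C) (p := q) (c := right_state))
  as (q2 & Hq2 & image2); auto using uedge_irrefl.
{ intros n u v Hu Hv; apply (step n u v Hu Hv). }
{ intros n u Hu Hn; apply (last n u Hu Hn). }
exists q1, q2; split; [exact Hq1|split; [exact Hq2|split; auto]].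
Qed.

Lemma hat_par (u v : ustate) : valid_state (par_state u v) ->
  dec_par_state defn (hat (par_state u v)) (hat u) (hat v).
Proof.
destruct u as [P|x], v as [Q|y]; cbn [par_state valid_state]; intros V; constructor;
  now apply is_derivation_iff.
Qed.

Lemma stutter_image_tracks (c : ustate -> ustate) (q q1 : sequence ustate) :
  stutter_image c q q1 -> exists l, tracks (hat_path q) (hat_path q1) l /\
    forall n u, q n = Some u -> q1 (l n) = Some (c u).
Proof.
intros (l & (start & slow & onto) & image); exists l; split; auto.
split; [exact start|split; [exact slow|]]; intros m Hm.
apply (occurs_map_seq (@hat A B C)) in Hm; destruct (onto m Hm) as (n & Hn & E).
exists n; split; auto; now apply (occurs_map_seq (@hat A B C)).
Qed.

Lemma hat_par_composition (q q1 q2 : sequence ustate) :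
  is_upath q -> is_upath q1 -> is_upath q2 -> par_composition q q1 q2 ->
  decomp_par defn (hat_path q) (hat_path q1) (hat_path q2).
Proof.
intros Hq Hq1 Hq2 (par & image1 & image2).
destruct (stutter_image_tracks image1) as (l & tracks1 & E1).
destruct (stutter_image_tracks image2) as (r & tracks2 & E2).
split; [now apply hat_upath|split; [now apply hat_upath|]].
exists l, r; split; [exact tracks1|split; [exact tracks2|]]; intros n s Hs.
apply (map_seq_Some (@hat A B C)) in Hs; destruct Hs as (u & Hu & ->).
assert (V := upath_valid Hq Hu); rewrite (par _ _ Hu) in V |- *.
exists (hat (left_state u)), (hat (right_state u)); unfold hat_path.
rewrite (E1 _ _ Hu), (E2 _ _ Hu); repeat split; now apply hat_par.
Qed.

Definition dec_op (o : unary_op) : sstate -> sstate -> Prop :=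
  match o with
  | Restrict c => dec_res_state defn c
  | Relabel f => dec_rel_state defn f
  end.

Lemma hat_op (o : unary_op) (u : ustate) : valid_state (op_state o u) ->
  dec_op o (hat (op_state o u)) (hat u).
Proof.
destruct o, u as [P|x]; cbn [op_state valid_state op_expr op_deriv dec_op]; intros V;
  constructor; now apply is_derivation_iff.
Qed.

Lemma uedge_op (o : unary_op) (u v : ustate) : uedge (op_state o u) v ->
  exists w, v = op_state o w /\ uedge u w.
Proof.
intros E; inversion E as [x D Eu Ev|x D Eu Ev]; apply is_derivation_iff in D;
  destruct u as [P|y]; try discriminate Eu; injection Eu as Eu.
- destruct (src_op_inv Eu) as [y ->]; rewrite src_op in Eu; apply op_expr_inj in Eu as <-.
  exists (UDeriv y); split; [reflexivity|constructor].
  apply valid_op in D; now apply is_derivation_iff.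
- subst x; exists (UExpr (target y)); rewrite target_op; split; [reflexivity|constructor].
  apply valid_op in D; now apply is_derivation_iff.
Qed.

Definition operand (u : ustate) : ustate :=
  match u with
  | UExpr (Res P _) | UExpr (Rel P _) => UExpr P
  | UDeriv (DRes x _) | UDeriv (DRel x _) => UDeriv x
  | _ => u
  end.

Lemma operand_op_state (o : unary_op) (u : ustate) : operand (op_state o u) = u.
Proof. now destruct o, u. Qed.

Lemma upath_op (o : unary_op) (q : sequence ustate) (P : expr) :
  is_upath q -> q 0 = Some (UExpr (op_expr o P)) ->
  exists q1, is_upath q1 /\ q = map_seq (op_state o) q1.
Proof.
intros Hq H0.
assert (form : forall n u, q n = Some u -> u = op_state o (operand u)).
{ apply (path_invariant Hq H0); [now destruct o|].
  intros u v E Hu; rewrite Hu in E; destruct (uedge_op E) as (w & -> & _).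
  now rewrite operand_op_state. }
assert (E : q = map_seq (op_state o) (map_seq operand q)).
{ apply functional_extensionality; intros n; unfold map_seq.
  destruct (q n) as [u|] eqn:Hu; [simpl; f_equal; eauto|reflexivity]. }
exists (map_seq operand q); split; [|exact E].
rewrite E in Hq; revert Hq; apply map_seq_path_inv.
- intros _ u v _ _ K; destruct (uedge_op K) as (w & Ew & K').
  now rewrite <- (operand_op_state o v), Ew, operand_op_state.
- intros [R|x] [S Es]; [now exists R|discriminate].
Qed.

Lemma hat_decomp_unary (o : unary_op) (q : sequence ustate) :
  is_upath q -> is_upath (map_seq (op_state o) q) ->
  decomp_unary defn (dec_op o) (hat_path (map_seq (op_state o) q)) (hat_path q).
Proof.
intros Hq Hoq; split; [now apply hat_upath|]; intros n; unfold hat_path, map_seq.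
destruct (q n) as [u|] eqn:Hu; simpl; [|exact I].
apply hat_op, (upath_valid Hoq (n := n)), map_seq_Some; eauto.
Qed.

Definition fairly_liftable (Y : hset) (p : sequence sstate) : Prop :=
  exists q, is_upath q /\ p = hat_path q /\ fair Y q.

Lemma fairly_liftable_sub (Y Z : hset) (p : sequence sstate) :
  (forall h, Y h -> Z h) -> fairly_liftable Y p -> fairly_liftable Z p.
Proof.
intros sub (q & Hq & E & F); exists q; split; [exact Hq|split; [exact E|]].
intros t H; destruct (F t H) as (h & L & Yh); exists h; auto.
Qed.

Lemma hat_path_expr (q : sequence ustate) (n : nat) (P : expr) :
  hat_path q n = Some (SExpr P) -> q n = Some (UExpr P).
Proof.
unfold hat_path; destruct (q n) as [[R|x]|]; simpl; intros E; [congruence|discriminate..].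
Qed.

Lemma fairly_liftable_finite (Y : hset) (p : sequence sstate) : fairly_liftable Y p ->
  forall n P, p n = Some (SExpr P) -> p (1 + n) = None ->
  forall a Q, transition defn P a Q -> in_Y_or_receive Y a.
Proof.
intros (q & Hq & -> & F) n P Hn Hn' a Q T.
apply transition_iff in T; destruct T as (x & V & Sx & <- & _).
destruct (classic (is_receive (label x))) as [R|N]; [now right|left].
rewrite <- label_canon by auto; apply F.
apply (eventually_always_last _ Hq (hat_path_expr Hn)); [now apply map_seq_None in Hn'|].
apply canon_enabled_intro; auto; now apply eqd_dom_iff.
Qed.

Lemma fairly_liftable_suffix (Y : hset) (p : sequence sstate) : fairly_liftable Y p ->
  forall n, occurs p n -> fairly_liftable Y (suffix n p).
Proof.
intros (q & Hq & -> & F) n Hn; apply (occurs_map_seq (@hat A B C)) in Hn.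
exists (suffix n q); split; [now apply path_suffix|split; [reflexivity|]].
intros t H; apply F; now apply eventually_always_suffix in H.
Qed.

Lemma fairly_liftable_par (Y : hset) (p : sequence sstate) : fairly_liftable Y p ->
  forall P Q, p 0 = Some (SExpr (Par P Q)) ->
  exists (p1 p2 : sequence sstate) (X Z : hset),
    decomp_par defn p p1 p2 /\ fairly_liftable X p1 /\ fairly_liftable Z p2 /\
    (forall h, X h \/ Z h -> Y h) /\ (forall h, ~ (X h /\ Z (bar h))).
Proof.
intros (q & Hq & -> & F) P Q H0.
destruct (upath_par Hq (hat_path_expr H0)) as (q1 & q2 & Hq1 & Hq2 & comp).
destruct (fair_par_components Hq comp F) as (X & Z & F1 & F2 & K).
exists (hat_path q1), (hat_path q2), X, Z.
split; [now apply hat_par_composition|].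
split; [now exists q1|split; [now exists q2|exact K]].
Qed.

Lemma fairly_liftable_op (o : unary_op) (Y : hset) (p : sequence sstate) : fairly_liftable Y p ->
  forall P, p 0 = Some (SExpr (op_expr o P)) ->
  exists p1, decomp_unary defn (dec_op o) p p1 /\ fairly_liftable (op_hset o Y) p1.
Proof.
intros (q & Hq & -> & F) P H0.
destruct (upath_op Hq (hat_path_expr H0)) as (q1 & Hq1 & ->).
exists (hat_path q1); split; [now apply hat_decomp_unary|].
exists q1; split; [exact Hq1|split; [reflexivity|now apply fair_op_operand]].
Qed.

Lemma fairly_liftable_family : just_family defn fairly_liftable.
Proof.
split.
- intros Y p (q & Hq & -> & _); now apply hat_upath.
- exact fairly_liftable_finite.
- exact fairly_liftable_par.
- intros Y p F P c; exact (@fairly_liftable_op (Restrict c) Y p F P).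
- intros Y p F P f; exact (@fairly_liftable_op (Relabel f) Y p F P).
- exact fairly_liftable_suffix.
Qed.


(** * Just paths have fair lifts *)

Lemma Y_just_family : just_family defn (Y_just defn).
Proof. exact (proj1 (Y_just_largest defn)). Qed.

Record par_split : Type := ParSplit {
  split_l : sequence sstate;
  split_r : sequence sstate;
  hset_l : hset;
  hset_r : hset;
  pos_l : nat -> nat;
  pos_r : nat -> nat;
  pos_l_le : forall n, pos_l n <= n;
  pos_r_le : forall n, pos_r n <= n
}.

Record splits (Y : hset) (p : sequence sstate) (d : par_split) : Prop := Splits {
  splits_tracks_l : tracks p (split_l d) (pos_l d);
  splits_tracks_r : tracks p (split_r d) (pos_r d);
  splits_states : forall n s, p n = Some s -> exists s1 s2,
    split_l d (pos_l d n) = Some s1 /\ split_r d (pos_r d n) = Some s2 /\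
    dec_par_state defn s s1 s2;
  splits_just_l : Y_just defn (hset_l d) (split_l d);
  splits_just_r : Y_just defn (hset_r d) (split_r d);
  splits_sub : forall h, hset_l d h \/ hset_r d h -> Y h;
  splits_disjoint : forall h, ~ (hset_l d h /\ hset_r d (bar h))
}.

Definition empty_seq : sequence sstate := fun _ => None.

Definition empty_split : par_split :=
  @ParSplit empty_seq empty_seq (fun _ => False) (fun _ => False) id id le_n le_n.

Definition the_par_split (Y : hset) (p : sequence sstate) : par_split :=
  epsilon (inhabits empty_split) (splits Y p).

Lemma the_par_split_spec (Y : hset) (p : sequence sstate) (P Q : expr) :
  Y_just defn Y p -> p 0 = Some (SExpr (Par P Q)) -> splits Y p (the_par_split Y p).
Proof.
intros J H0; unfold the_par_split; apply epsilon_spec.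
destruct (jf_par Y_just_family J H0) as (p1 & p2 & X & Z & D & J1 & J2 & sub & disj).
destruct D as (_ & _ & l & r & Tl & Tr & D).
assert (Ll : forall n, l n <= n) by exact (slow_le (proj1 Tl) (proj1 (proj2 Tl))).
assert (Lr : forall n, r n <= n) by exact (slow_le (proj1 Tr) (proj1 (proj2 Tr))).
now exists (ParSplit p1 p2 X Z Ll Lr).
Qed.

Definition op_splits (o : unary_op) (Y : hset) (p p1 : sequence sstate) : Prop :=
  decomp_unary defn (dec_op o) p p1 /\ Y_just defn (op_hset o Y) p1.

Definition the_op_split (o : unary_op) (Y : hset) (p : sequence sstate) : sequence sstate :=
  epsilon (inhabits empty_seq) (op_splits o Y p).

Lemma the_op_split_spec (o : unary_op) (Y : hset) (p : sequence sstate) (P : expr) :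
  Y_just defn Y p -> p 0 = Some (SExpr (op_expr o P)) ->
  op_splits o Y p (the_op_split o Y p).
Proof.
intros J H0; unfold the_op_split; apply epsilon_spec; destruct o as [c|f].
- exact (jf_res Y_just_family J H0).
- exact (jf_rel Y_just_family J H0).
Qed.

Definition composed (P : expr) : Prop :=
  match P with Par _ _ | Res _ _ | Rel _ _ => True | _ => False end.

(* [Nil] stands for the absence of a first expression. *)
Definition root (p : sequence sstate) : expr :=
  match p 0 with Some (SExpr P) => P | _ => Nil end.

Lemma root_eq (p : sequence sstate) (P : expr) : p 0 = Some (SExpr P) -> root p = P.
Proof. unfold root; now intros ->. Qed.

Lemma root_composed (p : sequence sstate) (P : expr) :
  root p = P -> composed P -> p 0 = Some (SExpr P).
Proof.
unfold root; destruct (p 0) as [[Q|Q a R]|]; intros <- CP; [reflexivity|destruct CP..].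
Qed.

Lemma root_par_split (Y : hset) (p : sequence sstate) (P Q : expr) (d : par_split) :
  splits Y p d -> p 0 = Some (SExpr (Par P Q)) -> root (split_l d) = P /\ root (split_r d) = Q.
Proof.
intros D H0; destruct (splits_states D H0) as (s1 & s2 & H1 & H2 & K).
rewrite (proj1 (splits_tracks_l D)) in H1; rewrite (proj1 (splits_tracks_r D)) in H2.
inversion K; subst; split; now apply root_eq.
Qed.

Lemma occurs_par_split (Y : hset) (p : sequence sstate) (d : par_split) (n : nat) :
  splits Y p d -> occurs p n ->
  occurs (split_l d) (pos_l d n) /\ occurs (split_r d) (pos_r d n).
Proof.
intros D Hn; apply occurs_iff in Hn; destruct Hn as [s Hs].
destruct (splits_states D Hs) as (s1 & s2 & H1 & H2 & _).
split; apply occurs_iff; eauto.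
Qed.

Lemma op_split_None (o : unary_op) (Y : hset) (p p1 : sequence sstate) (n : nat) :
  op_splits o Y p p1 -> p1 n = None <-> p n = None.
Proof.
intros [[_ D] _]; specialize (D n); destruct (p n), (p1 n); try contradiction D;
  split; congruence.
Qed.

Lemma occurs_op_split (o : unary_op) (Y : hset) (p p1 : sequence sstate) (n : nat) :
  op_splits o Y p p1 -> occurs p1 n <-> occurs p n.
Proof. intros D; unfold occurs; now rewrite (op_split_None n D). Qed.

Lemma root_op_split (o : unary_op) (Y : hset) (p p1 : sequence sstate) (P : expr) :
  op_splits o Y p p1 -> p 0 = Some (SExpr (op_expr o P)) -> root p1 = P.
Proof.
intros [[_ D] _] H0; specialize (D 0); rewrite H0 in D.
destruct (p1 0) as [s|] eqn:H1; [|contradiction].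
destruct o; inversion D; subst; now apply root_eq.
Qed.

Definition lifts_to (s : option sstate) (u : ustate) : Prop := valid_state u /\ s = Some (hat u).

Lemma lifts_to_exists (p : sequence sstate) (n : nat) :
  is_spath p -> occurs p n -> exists u, lifts_to (p n) u.
Proof.
intros (_ & _ & edges & ends) Hn; apply occurs_iff in Hn; destruct Hn as [[P|P a Q] Hs].
- now exists (UExpr P).
- assert (T : transition defn P a Q).
  { destruct (p (1 + n)) as [t|] eqn:Ht.
    - assert (K := edges _ _ _ Hs Ht); now inversion K.
    - destruct (ends _ _ Hs Ht); discriminate. }
  apply transition_iff in T; destruct T as (x & V & <- & <- & <-).
  now exists (UDeriv x).
Qed.

Lemma lifts_to_par (s s1 s2 : sstate) (u v : ustate) : dec_par_state defn s s1 s2 ->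
  lifts_to (Some s1) u -> lifts_to (Some s2) v -> lifts_to (Some s) (par_state u v).
Proof.
intros D [Vu Eu] [Vv Ev]; injection Eu as Eu; injection Ev as Ev.
destruct D as [P Q|x Q D|x y D|P y D]; destruct u as [P'|x'], v as [Q'|y'];
  try discriminate Eu; try discriminate Ev; try apply is_derivation_iff in D;
  unfold lifts_to, hat_deriv in *; simpl in *; unfold hat_deriv in *; simpl in *.
- split; congruence.
- injection Eu as Sx Lx Tx; injection Ev as <-; rewrite Sx, Lx, Tx in *; tauto.
- injection Eu as Sx Lx Tx; injection Ev as Sy Ly Ty.
  rewrite Sx, Lx, Tx, Sy, Ly, Ty in *; tauto.
- injection Eu as <-; injection Ev as Sy Ly Ty; rewrite Sy, Ly, Ty in *; tauto.
Qed.

Lemma lifts_to_op (o : unary_op) (s s1 : sstate) (u : ustate) : dec_op o s s1 ->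
  lifts_to (Some s1) u -> lifts_to (Some s) (op_state o u).
Proof.
intros D [Vu Eu]; injection Eu as Eu.
destruct o; (destruct D as [P|x D]; destruct u as [P'|x'];
  try discriminate Eu; try apply is_derivation_iff in D;
  unfold lifts_to, hat_deriv in *; simpl in *; unfold hat_deriv in *; simpl in *;
  [split; congruence|injection Eu as Sx Lx Tx; rewrite Sx, Lx, Tx in *; tauto]).
Qed.

Lemma lifts_to_par_split (Y : hset) (p : sequence sstate) (d : par_split) (n : nat)
    (u v : ustate) :
  splits Y p d -> occurs p n -> lifts_to (split_l d (pos_l d n)) u ->
  lifts_to (split_r d (pos_r d n)) v -> lifts_to (p n) (par_state u v).
Proof.
intros D Hn; apply occurs_iff in Hn; destruct Hn as [s Hs].
destruct (splits_states D Hs) as (s1 & s2 & -> & -> & K); rewrite Hs.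
now apply lifts_to_par.
Qed.

Lemma lifts_to_op_split (o : unary_op) (Y : hset) (p p1 : sequence sstate) (n : nat)
    (u : ustate) :
  op_splits o Y p p1 -> lifts_to (p1 n) u -> lifts_to (p n) (op_state o u).
Proof.
intros [[_ D] _] [Vu E]; specialize (D n); rewrite E in D.
destruct (p n) as [s|]; [apply (lifts_to_op D); now split|contradiction].
Qed.

Definition lift_start (p : sequence sstate) : ustate :=
  epsilon (inhabits (UExpr Nil)) (lifts_to (p 0)).

Lemma lift_start_lifts (p : sequence sstate) : is_spath p -> lifts_to (p 0) (lift_start p).
Proof.
intros Hp; unfold lift_start; apply epsilon_spec, lifts_to_exists; [exact Hp|exact (proj1 Hp)].
Qed.

(* [later] resolves the positions that follow a step out of a prefix, a sum or
   an agent identifier. *)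
Fixpoint lift_from (later : hset -> sequence sstate -> nat -> ustate)
    (P : expr) (Y : hset) (p : sequence sstate) (n : nat) : ustate :=
  match P with
  | Par E F =>
      let d := the_par_split Y p in
      par_state (lift_from later E (hset_l d) (split_l d) (pos_l d n))
                (lift_from later F (hset_r d) (split_r d) (pos_r d n))
  | Res E c =>
      let o := Restrict c in
      op_state o (lift_from later E (op_hset o Y) (the_op_split o Y p) n)
  | Rel E f =>
      let o := Relabel f in
      op_state o (lift_from later E (op_hset o Y) (the_op_split o Y p) n)
  | _ =>
      match n with
      | 0 => lift_start p
      | S m => later Y (suffix 1 p) m
      end
  end.

(* [k] is fuel: the value is junk at positions beyond [k]. *)
Fixpoint lift_upto (k : nat) (Y : hset) (p : sequence sstate) : nat -> ustate :=
  let later := match k with 0 => fun _ _ _ => UExpr Nil | S k' => lift_upto k' end in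
  lift_from later (root p) Y p.

Lemma lift_from_ext (f g : hset -> sequence sstate -> nat -> ustate) (n : nat) :
  (forall m Y p, m < n -> f Y p m = g Y p m) ->
  forall P m Y p, m <= n -> lift_from f P Y p m = lift_from g P Y p m.
Proof.
intros fg P; induction P as [|a E _|E _ F _|E IHE F IHF|E IH c|E IH f'|X]; intros m Y p L; simpl;
  try (destruct m; [reflexivity|now apply fg]).
- set (d := the_par_split Y p); assert (Ll := pos_l_le d m); assert (Lr := pos_r_le d m).
  rewrite IHE, IHF; [reflexivity|lia..].
- now rewrite IH.
- now rewrite IH.
Qed.

Lemma lift_upto_stable (k k' n : nat) (Y : hset) (p : sequence sstate) :
  n <= k -> n <= k' -> lift_upto k Y p n = lift_upto k' Y p n.
Proof.
revert k' n Y p; induction k as [|k IH]; intros [|k'] n Y p L L'; simpl;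
  apply lift_from_ext with (n := n); auto; intros m Y' p' Lm; try lia.
apply IH; lia.
Qed.

Lemma lift_from_lifts (later : hset -> sequence sstate -> nat -> ustate) (n : nat) :
  (forall m Y p, m < n -> Y_just defn Y p -> occurs p m -> lifts_to (p m) (later Y p m)) ->
  forall P m Y p, m <= n -> Y_just defn Y p -> root p = P -> occurs p m ->
  lifts_to (p m) (lift_from later P Y p m).
Proof.
intros Hlater.
assert (uncomposed : forall Y p m, m <= n -> Y_just defn Y p -> occurs p m ->
  lifts_to (p m) (match m with 0 => lift_start p | S m' => later Y (suffix 1 p) m' end)).
{ intros Y p [|m] L J Hm; assert (Hp := jf_path Y_just_family J).
  - now apply lift_start_lifts.
  - apply (Hlater m Y (suffix 1 p)); auto.
    apply (jf_suffix Y_just_family J), (path_occurs_le Hp) with (2 := Hm); lia. }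
intros P; induction P as [|a E _|E _ F _|E IHE F IHF|E IH c|E IH f|X]; intros m Y p L J R Hm; simpl;
  try now apply uncomposed.
all: apply root_composed in R; try exact I.
- assert (D := the_par_split_spec J R); destruct (root_par_split D R) as [Rl Rr].
  destruct (occurs_par_split D Hm) as [Hl Hr].
  assert (Ll := pos_l_le (the_par_split Y p) m); assert (Lr := pos_r_le (the_par_split Y p) m).
  apply (lifts_to_par_split D Hm).
  + apply IHE; auto; [lia|apply (splits_just_l D)].
  + apply IHF; auto; [lia|apply (splits_just_r D)].
- assert (D := the_op_split_spec (o := Restrict c) J R).
  apply (lifts_to_op_split D), IH; auto; [apply D|exact (root_op_split D R)|].
  now apply (occurs_op_split _ D).
- assert (D := the_op_split_spec (o := Relabel f) J R).
  apply (lifts_to_op_split D), IH; auto; [apply D|exact (root_op_split D R)|].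
  now apply (occurs_op_split _ D).
Qed.

Lemma lift_upto_lifts (k n : nat) (Y : hset) (p : sequence sstate) :
  n <= k -> Y_just defn Y p -> occurs p n -> lifts_to (p n) (lift_upto k Y p n).
Proof.
revert n Y p; induction k as [|k IH]; intros n Y p L J Hn; simpl;
  apply lift_from_lifts with (n := n); auto; intros m Y' p' Lm; try lia.
apply IH; lia.
Qed.

Definition lift (Y : hset) (p : sequence sstate) : sequence ustate :=
  fun n => option_map (fun _ => lift_upto n Y p n) (p n).

Lemma lift_Some (Y : hset) (p : sequence sstate) (k n : nat) :
  n <= k -> occurs p n -> lift Y p n = Some (lift_upto k Y p n).
Proof.
intros L Hn; apply occurs_iff in Hn; destruct Hn as [s Hs]; unfold lift; rewrite Hs; simpl.
f_equal; now apply lift_upto_stable.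
Qed.

Lemma occurs_lift (Y : hset) (p : sequence sstate) (n : nat) : occurs (lift Y p) n <-> occurs p n.
Proof. unfold occurs, lift; destruct (p n); simpl; split; congruence. Qed.

Lemma lift_lifts (Y : hset) (p : sequence sstate) (n : nat) (u : ustate) :
  Y_just defn Y p -> lift Y p n = Some u -> lifts_to (p n) u.
Proof.
intros J Hu; assert (Hn : occurs p n) by (apply (occurs_lift Y), occurs_iff; eauto).
rewrite (lift_Some Y (le_n n) Hn) in Hu; injection Hu as <-; now apply lift_upto_lifts.
Qed.

Lemma hat_lift (Y : hset) (p : sequence sstate) : Y_just defn Y p -> hat_path (lift Y p) = p.
Proof.
intros J; apply functional_extensionality; intros n; unfold hat_path.
destruct (lift Y p n) as [u|] eqn:Hu; simpl.
- symmetry; apply (lift_lifts J Hu).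
- symmetry; unfold lift in Hu; destruct (p n); [discriminate|reflexivity].
Qed.

Lemma lift_upath (Y : hset) (p : sequence sstate) : Y_just defn Y p -> is_upath (lift Y p).
Proof.
intros J; assert (Hp := jf_path Y_just_family J); rewrite <- (hat_lift J) in Hp; revert Hp.
apply map_seq_path_inv.
- intros n u v Hu Hv E; destruct (lift_lifts J Hu) as [Vu _], (lift_lifts J Hv) as [Vv _].
  destruct u as [P|x], v as [P'|y]; simpl in *; inversion E; subst;
    constructor; now apply is_derivation_iff.
- intros [P|x] [Q E]; [now exists P|discriminate].
Qed.

Lemma lift_suffix (Y : hset) (p : sequence sstate) : ~ composed (root p) ->
  suffix 1 (lift Y p) = lift Y (suffix 1 p).
Proof.
intros N; apply functional_extensionality; intros n; unfold suffix, lift; simpl.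
destruct (root p); simpl in N |- *; tauto || reflexivity.
Qed.

Lemma lift_upto_par (k n : nat) (Y : hset) (p : sequence sstate) (d : par_split) :
  root p = Par (root (split_l d)) (root (split_r d)) -> d = the_par_split Y p ->
  lift_upto k Y p n =
  par_state (lift_upto k (hset_l d) (split_l d) (pos_l d n))
            (lift_upto k (hset_r d) (split_r d) (pos_r d n)).
Proof. intros R ->; destruct k; simpl; now rewrite R. Qed.

Lemma lift_upto_op (k n : nat) (o : unary_op) (Y : hset) (p p1 : sequence sstate) :
  root p = op_expr o (root p1) -> p1 = the_op_split o Y p ->
  lift_upto k Y p n = op_state o (lift_upto k (op_hset o Y) p1 n).
Proof. intros R ->; destruct o, k; simpl in R |- *; now rewrite R. Qed.

Lemma lift_stutter_image (c : ustate -> ustate) (X Y : hset) (p p1 : sequence sstate)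
    (l : nat -> nat) :
  tracks p p1 l -> (forall n w, lift Y p n = Some w -> lift X p1 (l n) = Some (c w)) ->
  stutter_image c (lift Y p) (lift X p1).
Proof.
intros (start & slow & onto) image; exists l; split; [|exact image].
split; [exact start|split; [exact slow|]]; intros m Hm; apply occurs_lift in Hm.
destruct (onto m Hm) as (n & Hn & E); exists n; now rewrite occurs_lift.
Qed.

Lemma lift_par (Y : hset) (p : sequence sstate) (P Q : expr) (d : par_split) :
  Y_just defn Y p -> p 0 = Some (SExpr (Par P Q)) -> d = the_par_split Y p ->
  par_composition (lift Y p) (lift (hset_l d) (split_l d)) (lift (hset_r d) (split_r d)).
Proof.
intros J H0 Hd; assert (D := the_par_split_spec J H0); rewrite <- Hd in D.
assert (R : root p = Par (root (split_l d)) (root (split_r d))).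
{ destruct (root_par_split D H0) as [-> ->]; now apply root_eq. }
assert (E : forall n w, lift Y p n = Some w -> exists u v, w = par_state u v /\
  lift (hset_l d) (split_l d) (pos_l d n) = Some u /\
  lift (hset_r d) (split_r d) (pos_r d n) = Some v).
{ intros n w Hw; assert (Hn : occurs p n) by (apply (occurs_lift Y), occurs_iff; eauto).
  destruct (occurs_par_split D Hn) as [Hl Hr].
  rewrite (lift_Some Y (le_n n) Hn), (lift_upto_par n n R Hd) in Hw; injection Hw as <-.
  rewrite (lift_Some _ (pos_l_le d n) Hl), (lift_Some _ (pos_r_le d n) Hr); eauto. }
split; [|split].
- intros n w Hw; destruct (E n w Hw) as (u & v & -> & _).
  now rewrite left_par_state, right_par_state.
- apply (lift_stutter_image (splits_tracks_l D)); intros n w Hw.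
  destruct (E n w Hw) as (u & v & -> & Hu & _); now rewrite left_par_state.
- apply (lift_stutter_image (splits_tracks_r D)); intros n w Hw.
  destruct (E n w Hw) as (u & v & -> & _ & Hv); now rewrite right_par_state.
Qed.

Lemma lift_op (o : unary_op) (Y : hset) (p p1 : sequence sstate) (P : expr) :
  Y_just defn Y p -> p 0 = Some (SExpr (op_expr o P)) -> p1 = the_op_split o Y p ->
  lift Y p = map_seq (op_state o) (lift (op_hset o Y) p1).
Proof.
intros J H0 E; assert (D := the_op_split_spec J H0); rewrite <- E in D.
assert (R : root p = op_expr o (root p1)).
{ rewrite (root_op_split D H0); now apply root_eq. }
apply functional_extensionality; intros n; unfold map_seq, lift.
assert (N := op_split_None n D); destruct (p n), (p1 n); simpl.
- f_equal; now apply lift_upto_op.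
- discriminate (proj1 N eq_refl).
- discriminate (proj2 N eq_refl).
- reflexivity.
Qed.

Lemma component_ind (Phi : deriv -> Prop) :
  (forall t, (forall t', component t' t -> Phi t') -> Phi t) -> forall t, Phi t.
Proof.
intros step t; induction t; apply step; simpl; intros t' Ht; try contradiction;
  [destruct Ht|..]; subst; assumption.
Qed.

Lemma conc_target_composed (x y : deriv) : conc x y -> composed (target y).
Proof. intros H; induction H; simpl; auto. Qed.

Lemma persistent_reaches_composed (t : deriv) (q : sequence ustate) :
  is_upath q -> persistent t q ->
  exists n P, q n = Some (UExpr P) /\ (composed P \/ q (1 + n) = None).
Proof.
intros (_ & _ & edges & ends) (N & HN & H).
assert (after_deriv : forall n z, N <= n -> q n = Some (UDeriv z) ->
  exists P, q (1 + n) = Some (UExpr P) /\ composed P).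
{ intros n z L Hz; destruct (H n _ L Hz) as (x & _ & _ & K).
  destruct (q (1 + n)) as [v|] eqn:Hv; [|now destruct (ends _ _ Hz Hv)].
  assert (E := edges _ _ _ Hz Hv); inversion E; subst.
  eexists; split; [reflexivity|exact (conc_target_composed K)]. }
apply occurs_iff in HN; destruct HN as [[P|z] Hu].
- destruct (q (1 + N)) as [v|] eqn:Hv; [|eauto].
  assert (E := edges _ _ _ Hu Hv); inversion E; subst.
  destruct (after_deriv (1 + N) x) as (P & HP & CP); [lia|exact Hv|eauto].
- destruct (after_deriv N z) as (P & HP & CP); eauto.
Qed.

Lemma lift_fair_last (t : deriv) (Y : hset) (p : sequence sstate) (P : expr) :
  Y_just defn Y p -> p 0 = Some (SExpr P) -> p 1 = None -> fair_at Y (lift Y p) t.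
Proof.
intros J H0 H1 H; assert (Hq := H0); rewrite <- (hat_lift J) in Hq; apply hat_path_expr in Hq.
apply (eventually_always_last _ (lift_upath J) Hq) in H; [|unfold lift; simpl; now rewrite H1].
destruct H as (x & D & <- & Sx); apply eqd_dom_iff in D; destruct D as [V N].
rewrite label_canon by auto.
destruct (jf_finite Y_just_family J H0 H1 (a := label x) (Q := target x)) as [K|K];
  [|exact K|contradiction].
apply transition_iff; now exists x.
Qed.

Lemma lift_fair_composed (t : deriv) :
  (forall t', component t' t -> forall Y p, Y_just defn Y p -> fair_at Y (lift Y p) t') ->
  forall Y p, Y_just defn Y p -> composed (root p) -> fair_at Y (lift Y p) t.
Proof.
intros IH Y p J CP; assert (Hq := lift_upath J).
assert (H0 := root_composed eq_refl CP).
destruct (root p) as [| | |P Q|P c|P f|]; try contradiction.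
- assert (D := the_par_split_spec J H0).
  apply (fair_at_par Hq (lift_par J H0 eq_refl)) with (3 := splits_sub D) (4 := splits_disjoint D).
  + intros t' Ht; apply IH; [exact Ht|apply (splits_just_l D)].
  + intros t' Ht; apply IH; [exact Ht|apply (splits_just_r D)].
- assert (D := the_op_split_spec (o := Restrict c) J H0).
  rewrite (@lift_op (Restrict c) _ _ _ _ J H0 eq_refl) in *.
  apply fair_at_op; [exact Hq|intros t' Ht; apply IH; [exact Ht|apply D]].
- assert (D := the_op_split_spec (o := Relabel f) J H0).
  rewrite (@lift_op (Relabel f) _ _ _ _ J H0 eq_refl) in *.
  apply fair_at_op; [exact Hq|intros t' Ht; apply IH; [exact Ht|apply D]].
Qed.

Lemma lift_fair (Y : hset) (p : sequence sstate) : Y_just defn Y p -> fair Y (lift Y p).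
Proof.
intros J t; revert Y p J; induction t as [t IH] using component_ind; intros Y p J H.
destruct (persistent_reaches_composed (lift_upath J) H) as (n & P & Hn & last).
revert p J H Hn last; induction n as [|n IHn]; intros p J H Hn last;
  (destruct (classic (composed (root p))) as [CP|NP]; [exact (lift_fair_composed IH J CP H)|]).
- assert (H0 : p 0 = Some (SExpr P)).
  { rewrite <- (hat_lift J); apply map_seq_Some; eauto. }
  rewrite (root_eq H0) in NP; destruct last as [CP|last]; [contradiction|].
  apply (lift_fair_last J H0); auto; unfold lift in last; simpl in last.
  destruct (p 1); [discriminate|reflexivity].
- assert (Hn' : occurs p 1).
  { apply (path_occurs_le (jf_path Y_just_family J) (m := 1 + n)); [lia|].
    apply (occurs_lift Y), occurs_iff; eauto. }
  assert (E := lift_suffix Y NP); apply (IHn (suffix 1 p)).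
  + now apply (jf_suffix Y_just_family J).
  + rewrite <- E; apply eventually_always_suffix; [now apply occurs_lift|exact H].
  + rewrite <- E; exact Hn.
  + rewrite <- E; exact last.
Qed.

Lemma Y_just_iff_fairly_liftable (Y : hset) (p : sequence sstate) :
  Y_just defn Y p <-> fairly_liftable Y p.
Proof.
split.
- intros J; exists (lift Y p); split; [now apply lift_upath|split; [|now apply lift_fair]].
  symmetry; now apply hat_lift.
- intros F; exists fairly_liftable; split; [exact fairly_liftable_family|exact F].
Qed.

(** * Temporal formulas *)

Lemma enabled_iff_canon_enabled (x : deriv) (nu : deriv -> Prop) (u : ustate) :
  eqd_dom x -> (forall y, nu y <-> eqd x y) ->
  enabled defn nu u <-> canon_enabled (canon x) u.
Proof.
intros Dx Hnu; destruct u as [P|z]; simpl; split; intros (y & K).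
- destruct K as [K ->]; apply Hnu, eqd_iff_canon in K; exists y; simpl; intuition.
- destruct K as (Dy & E & <-); exists y; rewrite Hnu, eqd_iff_canon; auto.
- destruct K as [K L]; apply Hnu, eqd_iff_canon in K; exists y; simpl; intuition.
- destruct K as (Dy & E & L); exists y; rewrite Hnu, eqd_iff_canon; auto.
Qed.

Definition weakly_fair (nu : deriv -> Prop) (q : sequence ustate) : Prop :=
  ltl_imp (ltl_F (ltl_G (ltl_atom (enabled defn nu)))) (ltl_G (ltl_F (ltl_atom (holds_abs nu)))) q.

Lemma weakly_fair_iff_not_persistent (x : deriv) (nu : deriv -> Prop) (q : sequence ustate) :
  eqd_dom x -> (forall y, nu y <-> eqd x y) ->
  weakly_fair nu q <-> ~ persistent (canon x) q.
Proof.
intros Dx Hnu; assert (en := fun u => enabled_iff_canon_enabled u Dx Hnu).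
assert (FG : eventually_always (enabled defn nu) q <-> persistent (canon x) q).
{ split; apply eventually_always_sub; intros n u _; apply en. }
unfold weakly_fair, ltl_imp; rewrite ltl_FG_atom, ltl_GF_atom, FG; split; [|tauto].
intros GF H; assert (H' := H); destruct H' as (N & HN & K).
destruct (GF H N HN) as (n & u & L & Hu & nu_u); destruct u as [P|z]; [contradiction|].
apply Hnu, eqd_iff_canon in nu_u; destruct nu_u as (_ & _ & E).
apply (@not_enabled_while_occurring z); rewrite <- E; exact (K n _ L Hu).
Qed.

Lemma non_blocking_iff (x : deriv) : eqd_dom x ->
  non_blocking (label x) <-> ~ handshake_in (fun _ => True) (label x).
Proof.
rewrite eqd_dom_iff; intros [_ N]; unfold non_blocking, handshake_in, is_send; split.
- intros [(b & ->)| ->] (h & E & _); discriminate.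
- intros K; destruct (label x) as [b [] |h|].
  + left; now exists b.
  + destruct N; now exists b.
  + destruct K; eauto.
  + now right.
Qed.

Lemma non_blocking_weakly_fair_iff (q : sequence ustate) :
  (forall nu, abstract_transition defn nu ->
     (exists a, abs_label nu a /\ non_blocking a) -> weakly_fair nu q) <->
  fair (fun _ => True) q.
Proof.
split.
- intros wf t H; destruct (eventually_always_somewhere H) as (_ & u & _ & x & D & <- & _).
  assert (V := proj1 (proj1 (eqd_dom_iff x) D)); rewrite (label_canon V).
  apply NNPP; intros N; assert (self : forall y, eqd x y <-> eqd x y) by reflexivity.
  apply (weakly_fair_iff_not_persistent q D self) in H; [contradiction|]; apply wf.
  + now exists x.
  + exists (label x); split; [|now apply non_blocking_iff].
    exists x; split; [now apply eqd_refl|reflexivity].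
- intros F nu (x & D & Hnu) (a & (y & nu_y & <-) & nb).
  apply (weakly_fair_iff_not_persistent q D Hnu); intros H; apply F in H.
  apply Hnu, eqd_iff_canon in nu_y; destruct nu_y as (_ & Dy & E).
  rewrite E, label_canon in H by (now apply eqd_dom_iff in Dy).
  now apply (non_blocking_iff Dy) in nb.
Qed.

End ABC.

Theorem theorem3 (A B C : Type) (defn : A -> expr A B C)
    (Hguarded : forall X : A, guarded (defn X))
    (rho : sequence (sstate A B C)) (Hrho : is_spath defn rho) :
  just defn rho <->
  exists pi : sequence (ustate A B C),
    is_upath defn pi /\
    rho = hat_path pi /\
    forall nu : deriv A B C -> Prop,
      abstract_transition defn nu ->
      (exists a : act B C, abs_label nu a /\ non_blocking a) ->
      ltl_imp (ltl_F (ltl_G (ltl_atom (enabled defn nu))))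
              (ltl_G (ltl_F (ltl_atom (holds_abs nu)))) pi.
Proof.
transitivity (fairly_liftable defn (fun _ => True) rho); split.
- intros [Y J]; apply (Y_just_iff_fairly_liftable Hguarded) in J.
  now apply (fairly_liftable_sub (Y := Y)).
- intros F; exists (fun _ => True); now apply Y_just_iff_fairly_liftable.
- intros (pi & Hpi & E & F); exists pi; split; [exact Hpi|split; [exact E|]].
  now apply non_blocking_weakly_fair_iff.
- intros (pi & Hpi & E & wf); exists pi; split; [exact Hpi|split; [exact E|]].
  now apply non_blocking_weakly_fair_iff.
Qed.
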